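(* Let $n\ge2$, let $X=X_{n+3}$ be the affine cone over the Grassmannian $\mathrm{Gr}_{2,n+3}$ taken in its Plücker embedding, with Plücker coordinates $\Delta_{ab}$ ($1\le a<b\le n+3$), and let $\mathcal{A}_\circ$ be the special cluster algebra of type $A_n$ defined in the context, with cluster variables $x_{ab}$ labeled by the diagonals $[a,b]$ and coefficient generators $p_{ab}$ labeled by the sides $[a,b]$ of a regular $(n+3)$-gon with vertices numbered $1,\dots,n+3$ counterclockwise. The correspondence sending each cluster variable $x_{ab}$ and each coefficient $p_{ab}$ to the corresponding element $\Delta_{ab}$ extends uniquely to an algebra isomorphism between the cluster algebra $\mathcal{A}_\circ$ and the $\mathbb{Z}$-form $\mathbb{Z}[X]$ of $\mathbb{C}[X]$ generated by all Plücker coordinates.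
   Context: Cluster algebras. A semifield $(\mathbb{P},\oplus,\cdot)$ is an abelian multiplicative group with a commutative, associative operation $\oplus$ over which multiplication distributes. $\mathrm{Trop}(p_j:j\in J)$ ($J$ finite) is the semifield whose multiplicative group is free abelian on the $p_j$, with $\prod_jp_j^{a_j}\oplus\prod_jp_j^{b_j}=\prod_jp_j^{\min(a_j,b_j)}$. The ambient field $\mathcal{F}$ is isomorphic to the field of rational functions in $n$ variables with coefficients in $\mathbb{Z}\mathbb{P}$. A seed is $(\mathbf{x},\mathbf{p},B)$ with $\mathbf{x}\subset\mathcal{F}$ an $n$-element transcendence basis over the fraction field of $\mathbb{Z}\mathbb{P}$; $\mathbf{p}=(p_x^\pm)_{x\in\mathbf{x}}$ in $\mathbb{P}$ with $p_x^+\oplus p_x^-=1$; $B=(b_{xy})_{x,y\in\mathbf{x}}$ an integer matrix with, for all $x,y$, either $b_{xy}=b_{yx}=0$ or $b_{xy}b_{yx}<0$. Mutation at $z\in\mathbf{x}$: replace $z$ by $\overline z$ given by the exchange relation $z\overline z=p_z^+\prod_{b_{xz}>0}x^{b_{xz}}+p_z^-\prod_{b_{xz}<0}x^{-b_{xz}}$; new coefficients are normalized and satisfy $\overline p_x^+/\overline p_x^-=p_z^-/p_z^+$ if $x=\overline z$, $=(p_z^+)^{b_{zx}}p_x^+/p_x^-$ if $b_{zx}\ge0$, $=(p_z^-)^{b_{zx}}p_x^+/p_x^-$ if $b_{zx}\le0$; $B$ is replaced by $b'_{xy}=-b_{xy}$ if $x=z$ or $y=z$, $b'_{xy}=b_{xy}+\frac{|b_{xz}|b_{zy}+b_{xz}|b_{zy}|}{2}$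 otherwise, with the index $z$ relabeled $\overline z$. The cluster algebra generated from an initial seed is the subring of $\mathcal{F}$ generated by all cluster variables (elements of the sets $\mathbf{x}$) and all coefficients $p_x^\pm$ of all seeds obtained by iterated mutations. The algebra $\mathcal{A}_\circ$ of type $A_n$. Let $\mathbf{P}_{n+3}$ be a regular $(n+3)$-gon with vertices numbered $1,\dots,n+3$ counterclockwise; $\mathbb{P}=\mathrm{Trop}(p_{ab}:[a,b]\text{ is a side of }\mathbf{P}_{n+3})$; put $q_{ab}=p_{ab}$ if $[a,b]$ is a side and $q_{ab}=1$ if it is a diagonal. Fix any triangulation $T$ of $\mathbf{P}_{n+3}$ by non-crossing diagonals. The initial seed has cluster $\{x_{ab}:[a,b]\in T\}$. Its matrix $B(T)$, with rows and columns indexed by $T$, has $b_{\alpha\beta}=0$ unless $\alpha,\beta$ are two sides of some triangle $(a,b,c)$ of $T$, in which case, with $\alpha=[a,b]$, $\beta=[a,c]$, $b_{\alpha\beta}=1$ (resp. $-1$) if the order of $a,b,c$ is counterclockwise (resp. clockwise). For $\beta=[a,c]\in T$ the diagonal of the quadrilateral with vertices $a,b,c,d$ in counterclockwise order formed by the two triangles of $T$ adjacent to $\beta$, the coefficients are $p_\beta^+=q_{ab}q_{cd}$, $p_\beta^-=q_{ad}q_{bc}$. The cluster variables of $\mathcal{A}_\circ$ are in bijection $[a,b]\mapsto x_{ab}$ with all diagonals, the clusters correspond to all triangulations, and with the convention $x_{ab}=1$ for sides $[a,b]$, the exchange relations are $x_{ac}x_{bd}=q_{ab}q_{cd}\,x_{ab}x_{cd}+q_{ad}q_{bc}\,x_{ad}x_{bc}$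 for all vertices $a,b,c,d$ in counterclockwise order. ($\mathcal{A}_\circ$ does not depend on the choice of $T$.) The cone. $X$ is the variety of nonzero decomposable bivectors in $\bigwedge^2\mathbb{C}^{n+3}$; $\mathbb{C}[X]$ is generated by the Plücker coordinates $\Delta_{ab}$, and $\mathbb{Z}[X]$ is the subring generated by them (equivalently, by the $2\times2$ minors $\Delta_{ab}=z_{1a}z_{2b}-z_{1b}z_{2a}$ of a generic $2\times(n+3)$ matrix). A $\mathbb{Z}$-form of a commutative $\mathbb{C}$-algebra $R$ is a subring $R_{\mathbb{Z}}$ with $\mathbb{C}\otimes_{\mathbb{Z}}R_{\mathbb{Z}}\cong R$ via multiplication. *)

(* Defs.v *)
From HB Require Import structures.
From mathcomp Require Import all_boot all_order all_algebra.
From mathcomp Require Import boolp functions reals complex.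
From mathcomp Require Import mpoly.

Set Implicit Arguments.
Unset Strict Implicit.
Unset Printing Implicit Defensive.

Import Order.TTheory GRing.Theory Num.Theory.
Local Open Scope ring_scope.

Section GeneratedSubring.
Variables (A : comPzRingType) (S : A -> Prop).

Definition in_subring_gen : {pred A} := fun x =>
  `[< forall P : {pred A},
        subring_closed P -> (forall y, S y -> y \in P) -> x \in P >].

Lemma subring_gen_closed : subring_closed in_subring_gen.
Proof.
split.
- by apply/asboolP => P [].
- move=> x y /asboolP Px /asboolP Py; apply/asboolP => P Pcl SP.
  by case: (Pcl) => _ PB _; apply: PB; [apply: Px | apply: Py].
- move=> x y /asboolP Px /asboolP Py; apply/asboolP => P Pcl SP.
  by case: (Pcl) => _ _ PM; apply: PM; [apply: Px | apply: Py].
Qed.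

HB.instance Definition _ := GRing.isSubringClosed.Build A in_subring_gen
  subring_gen_closed.

Lemma mem_subring_gen x : S x -> x \in in_subring_gen.
Proof. by move=> Sx; apply/asboolP => P _; apply. Qed.

Record subring_gen :=
  SubringGen { subring_gen_val : A; _ : subring_gen_val \in in_subring_gen }.

HB.instance Definition _ := [isSub for subring_gen_val].
HB.instance Definition _ := [Choice of subring_gen by <:].
HB.instance Definition _ :=
  GRing.SubChoice_isSubComPzRing.Build A in_subring_gen subring_gen
    subring_gen_closed.

End GeneratedSubring.

Definition ring_isomorphism (A B : pzRingType) (f : A -> B) : Prop :=
  [/\ zmod_morphism f, monoid_morphism f & bijective f].

(* [RZ] is a Z-form of the commutative C-algebra [R] with structure morphism
   [eta]: the multiplication C x RZ -> R, (c, r) |-> eta c * r, satisfies the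
   universal property of the tensor product of C and RZ over the integers. *)
Definition Z_form (C R : comPzRingType) (eta : {rmorphism C -> R})
    (P : {pred R}) (RZ : subComPzRingType P) : Prop :=
  forall (M : zmodType) (beta : C -> RZ -> M),
    (forall r, zmod_morphism (beta^~ r)) ->
    (forall c, zmod_morphism (beta c)) ->
  exists! g : R -> M,
    zmod_morphism g /\ forall c r, g (eta c * val r) = beta c r.

Section ClusterAlgebra.
Variables (J : finType) (n : nat).

(* Elements of the tropical semifield Trop(p_j : j in J) are given by their
   exponent vectors; its multiplicative group is therefore written additively:
   the product is +, the unit is 0, and p ^ a is p *~ a. *)
Definition trop := {ffun J -> int}.

Definition trop_oplus (p q : trop) : trop := [ffun j => Num.min (p j) (q j)].

Definition trop_var (j : J) : trop := [ffun i => (i == j)%:Z].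

(* Z P is the ring of Laurent polynomials in the p_j, so that its fraction field
   is that of the polynomial ring Z[p_j : j in J]. *)
Definition coef_field : fieldType := {fraction {mpoly int[#|J|]}}.

Definition ambient : fieldType := {fraction {mpoly coef_field[n]}}.

Definition coef_field_inj : coef_field -> ambient :=
  fun c => tofrac (mpolyC n c).

Definition trop_inj (p : trop) : ambient :=
  coef_field_inj
    (\prod_(j : J) (tofrac ('X_(enum_rank j) : {mpoly int[#|J|]})) ^ (p j)).

Variable I : finType.

Definition poly_eval (x : I -> ambient) (P : {mpoly coef_field[#|I|]}) :
    ambient :=
  mmap coef_field_inj (fun i => x (enum_val i)) P.

Definition transcendence_basis (x : I -> ambient) : Prop :=
  (forall P, poly_eval x P = 0 -> P = 0) /\
  (forall f : ambient, exists2 Q : {poly {mpoly coef_field[#|I|]}},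
     map_poly (poly_eval x) Q != 0 & root (map_poly (poly_eval x) Q) f).

(* The cluster is given as a family indexed by [I]; the coefficients and the
   exchange matrix are indexed by [I] as well, so that replacing z by its
   mutation does not change the index set.  The remaining conditions on a seed
   (the cluster is a transcendence basis, the coefficients are normalized, the
   matrix is sign-skew-symmetric) are preserved by mutation for
   skew-symmetric matrices and are only needed for the initial seed, where the
   first one is assumed and the others follow from the explicit formulas. *)
Record seed := Seed {
  cluster : I -> ambient;
  coef_pos : I -> trop;
  coef_neg : I -> trop;
  exch : I -> I -> int
}.

Definition mutation (s : seed) (k : I) (s' : seed) : Prop :=
  let b := exch s in
  [/\ (forall i, i != k -> cluster s' i = cluster s i),
      cluster s k * cluster s' k =
        trop_inj (coef_pos s k) * \prod_(i | 0 < b i k) cluster s i ^ b i k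
        + trop_inj (coef_neg s k) * \prod_(i | b i k < 0) cluster s i ^ - b i k,
      (forall i, trop_oplus (coef_pos s' i) (coef_neg s' i) = 0),
      (forall i, coef_pos s' i - coef_neg s' i =
         if i == k then coef_neg s k - coef_pos s k
         else (if 0 <= b k i then coef_pos s k *~ b k i
               else coef_neg s k *~ b k i)
              + (coef_pos s i - coef_neg s i)) &
      (forall i j, exch s' i j =
         if (i == k) || (j == k) then - b i j
         else b i j + ((`|b i k| * b k j + b i k * `|b k j|)%R %/ 2)%Z)].

Inductive mutation_equiv (s0 : seed) : seed -> Prop :=
| mutation_equiv_refl : mutation_equiv s0 s0
| mutation_equiv_step s k s' :
    mutation_equiv s0 s -> mutation s k s' -> mutation_equiv s0 s'.

Definition cluster_generator (s0 : seed) (z : ambient) : Prop :=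
  exists2 s, mutation_equiv s0 s &
    exists i, [\/ z = cluster s i, z = trop_inj (coef_pos s i)
                | z = trop_inj (coef_neg s i)].

Definition cluster_algebra (s0 : seed) := subring_gen (cluster_generator s0).

End ClusterAlgebra.

Section Polygon.
Variable n : nat.

(* The vertices 1, ..., n + 3 are the elements 0, ..., n + 2 of ['I_n.+3], and
   [a, b] is the set [set a; b]. *)
Notation V := 'I_n.+3.

Definition is_side (e : {set V}) : bool := [exists a : V, e == [set a; ordS a]].

Definition is_diagonal (e : {set V}) : bool := (#|e| == 2) && ~~ is_side e.

Definition ccw (a b c : V) : bool :=
  [|| (a < b < c)%N, (b < c < a)%N | (c < a < b)%N].

Definition ccw4 (a b c d : V) : bool := ccw a b c && ccw a c d.

Definition crossing (e f : {set V}) : bool :=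
  [exists a, exists b, exists c, exists d,
    [&& ccw4 a b c d, e == [set a; c] & f == [set b; d]]].

Definition noncrossing_diagonals (T : {set {set V}}) : bool :=
  [forall e in T, is_diagonal e] &&
  [forall e in T, forall f in T, ~~ crossing e f].

Definition triangulation (T : {set {set V}}) : bool :=
  maxset noncrossing_diagonals T.

Definition triangle_of (T : {set {set V}}) (a b c : V) : bool :=
  let edge e := is_side e || (e \in T) in
  [&& uniq [:: a; b; c], edge [set a; b], edge [set b; c] & edge [set a; c]].

Definition side : finType := {e : {set V} | is_side e}.

Definition q (a b : V) : trop side :=
  if insub [set a; b] is Some e then trop_var e else 0.

Definition diag_of (T : {set {set V}}) : finType := {e : {set V} | e \in T}.

Definition tri_seed (T : {set {set V}}) := seed side n (diag_of T).

Record initial_seed (T : {set {set V}}) (s : tri_seed T) : Prop := {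
  initial_cluster : transcendence_basis (cluster s);
  initial_coef : forall (beta : diag_of T) (a b c d : V),
    ccw4 a b c d -> triangle_of T a b c -> triangle_of T a c d ->
    val beta = [set a; c] ->
    coef_pos s beta = q a b + q c d /\ coef_neg s beta = q a d + q b c;
  initial_exch : forall (alpha beta : diag_of T) (a b c : V),
    triangle_of T a b c -> val alpha = [set a; b] -> val beta = [set a; c] ->
    exch s alpha beta = if ccw a b c then 1 else -1;
  initial_exch0 : forall alpha beta : diag_of T,
    (forall a b c : V, triangle_of T a b c ->
       val alpha = [set a; b] -> val beta <> [set a; c]) ->
    exch s alpha beta = 0
}.

Definition flip (T : {set {set V}}) (d : diag_of T -> {set V}) (k : diag_of T)
    (d' : diag_of T -> {set V}) : Prop :=
  [/\ (forall i, i != k -> d' i = d i), d' k != d k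
    & triangulation [set d' i | i : diag_of T]].

(* [labelled_seed s0 d s]: [s] is obtained from [s0] by iterated mutations, and
   following the corresponding flips of triangulations starting from [T], the
   cluster variable of index [i] in [s] is labelled by the diagonal [d i]. *)
Inductive labelled_seed (T : {set {set V}}) (s0 : tri_seed T) :
    (diag_of T -> {set V}) -> tri_seed T -> Prop :=
| labelled_seed_init : labelled_seed s0 val s0
| labelled_seed_step d s k d' s' :
    labelled_seed s0 d s -> mutation s k s' -> flip d k d' ->
    labelled_seed s0 d' s'.

Definition is_x (T : {set {set V}}) (s0 : tri_seed T) (a b : V)
    (z : ambient side n) : Prop :=
  exists d s i, [/\ labelled_seed s0 d s, d i = [set a; b] & z = cluster s i].

Definition is_p (a b : V) (z : ambient side n) : Prop := z = trop_inj n (q a b).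

Definition is_generator (T : {set {set V}}) (s0 : tri_seed T) (a b : V)
    (z : ambient side n) : Prop :=
  if is_side [set a; b] then is_p a b z else is_x s0 a b z.

End Polygon.

Section Cone.
Variables (C : fieldType) (n : nat).

(* A bivector is given by its alternating matrix of coordinates. *)
Definition cone : Type :=
  {w : 'M[C]_n.+3 | w != 0 /\
     exists u v : 'rV[C]_n.+3,
       w = \matrix_(a, b) (u 0 a * v 0 b - u 0 b * v 0 a)}.

Definition plucker_fun (a b : 'I_n.+3) : cone -> C := fun w => sval w a b.

Definition coord_ring_generator (f : cone -> C) : Prop :=
  (exists c : C, f = fun=> c) \/ (exists a b, f = plucker_fun a b).

(* C[X], as the C-algebra of functions on the cone generated by the Pluecker
   coordinates. *)
Definition coord_ring := subring_gen coord_ring_generator.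

Lemma const_mem (c : C) : (fun=> c) \in in_subring_gen coord_ring_generator.
Proof. by apply: mem_subring_gen; left; exists c. Qed.

Lemma plucker_mem (a b : 'I_n.+3) :
  plucker_fun a b \in in_subring_gen coord_ring_generator.
Proof. by apply: mem_subring_gen; right; exists a, b. Qed.

Definition coord_const (c : C) : coord_ring := SubringGen (const_mem c).

Definition plucker (a b : 'I_n.+3) : coord_ring := SubringGen (plucker_mem a b).

Lemma coord_const_is_zmod_morphism : zmod_morphism coord_const.
Proof. by move=> c c'; apply: val_inj. Qed.

Lemma coord_const_is_monoid_morphism : monoid_morphism coord_const.
Proof. by split=> [|c c']; apply: val_inj. Qed.

HB.instance Definition _ := GRing.isZmodMorphism.Build C coord_ring coord_const
  coord_const_is_zmod_morphism.
HB.instance Definition _ := GRing.isMonoidMorphism.Build C coord_ring coord_const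
  coord_const_is_monoid_morphism.

Definition Z_coord_ring_generator (f : coord_ring) : Prop :=
  exists a b : 'I_n.+3, (a < b)%N /\ f = plucker a b.

Definition Z_coord_ring := subring_gen Z_coord_ring_generator.

End Cone.

(* Main.v *)
From HB Require Import structures.
Require Import Defs.
From mathcomp Require Import all_boot all_order all_algebra.
From mathcomp Require Import boolp functions reals complex.
From mathcomp Require Import mpoly.
From mathcomp Require Import zify ring.

(** The two rings have generators labelled by the same set, the sides and diagonals of
    the polygon, and it is enough to show that the generators satisfy the same integer
    polynomial relations on both sides ([generated_iso]).

    Put the coefficient p_ab of a side [a, b] and the cluster variable x_ab of a diagonal
    into one family y.  The exchange relation of a seed becomes the Pluecker relation
    y_ac y_bd = y_ab y_cd + y_ad y_bc, and the coefficients of a seed become rows of an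
    extended exchange matrix.  A flip of a triangulation acts on the extended matrix by
    matrix mutation ([tri_matrix_flip]), so by induction every seed obtained from the
    initial one is the seed of a triangulation ([mutation_geometric]).

    The family y is constructed before any mutation is made.  Every 2 x 2 minor of a
    generic 2 x (n + 3) matrix is a rational function of the minors on the edges of the
    triangulation T ([edges_generate]), and these are algebraically independent, because
    their values can be prescribed to be arbitrary positive numbers
    ([positive_realization], [generic_embedding]).  The p_ab and the initial cluster
    variables are algebraically independent as well, because the initial cluster is a
    transcendence basis over the field of rational functions in the p_ab.  Hence the
    edges of T generate isomorphic fields on the two sides, and y is the image of the
    family of all minors ([cluster_coordinates]): it satisfies the same relations as the generic minors, which
    are the relations between Pluecker coordinates on the cone ([coord_relations]).

    Both flip arguments, and the fact that all y_ab belong to the cluster algebra, go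
    through the star of a vertex: from any triangulation, flips lead to the triangulation
    by all the diagonals at a given vertex ([flip_induction], [reach_star]).

    That the subring generated by the Pluecker coordinates is a Z-form comes from its
    embedding in a polynomial ring over the integers and the Smith normal form
    ([tensor_relation]). *)

Set Implicit Arguments.
Unset Strict Implicit.
Unset Printing Implicit Defensive.

Import Order.TTheory GRing.Theory Num.Theory.
Local Open Scope ring_scope.

(** * The cyclic order of the vertices *)

Section Polygon.
Variable n : nat.
Notation V := 'I_n.+3.
Implicit Types (T : {set {set V}}).

Lemma set2_eq (I : finType) (x y a b : I) :
  ([set x; y] == [set a; b]) =
  (x == a) && (y == b) || (x == b) && (y == a).
Proof.
apply/eqP/idP => [E|/orP[]/andP[/eqP-> /eqP->] //]; last exact: setUC.
have xab : x \in [set a; b] by rewrite -E set21.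
have yab : y \in [set a; b] by rewrite -E set22.
have axy : a \in [set x; y] by rewrite E set21.
have bxy : b \in [set x; y] by rewrite E set22.
move: xab yab axy bxy; rewrite !inE ![a == _]eq_sym ![b == _]eq_sym.
by do 4!case: eqP => //=.
Qed.

(** Successors modulo n + 3 in a form that linear arithmetic can use. *)
Lemma ordSP (a : V) :
  ((a < n.+2)%N /\ ordS a = a.+1 :> nat) \/ (a = n.+2 :> nat /\ ordS a = 0 :> nat).
Proof.
have := ltn_ord a; rewrite /= ltnS leq_eqVlt => /orP[/eqP->|lt].
  by right; rewrite modnn.
by left; rewrite modn_small.
Qed.

Lemma eq_ord (a b : V) : (a == b) = (a == b :> nat).
Proof. by []. Qed.

Lemma ccw_rot (a b c : V) : ccw b c a = ccw a b c.
Proof. rewrite /ccw; lia. Qed.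

Lemma ccw_neq (a b c : V) : ccw a b c -> [/\ a != b, b != c & a != c].
Proof. by rewrite !eq_ord /ccw; split; lia. Qed.

Lemma ccw_asym (a b c : V) : ccw a b c -> ~~ ccw a c b.
Proof. rewrite /ccw; lia. Qed.

Lemma ccw_total (a b c : V) : a != b -> b != c -> a != c -> ccw a b c || ccw a c b.
Proof. rewrite !eq_ord /ccw; lia. Qed.

Lemma ccw4_rot (a b c d : V) : ccw4 b c d a = ccw4 a b c d.
Proof. rewrite /ccw4 /ccw; lia. Qed.

Lemma ccw4_rot2 (a b c d : V) : ccw4 c d a b = ccw4 a b c d.
Proof. rewrite /ccw4 /ccw; lia. Qed.

Lemma ccw4_uniq (a b c d : V) : ccw4 a b c d -> uniq [:: a; b; c; d].
Proof.
rewrite /= !inE !negb_or !eq_ord /ccw4 /ccw => H.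
by repeat (apply/andP; split); rewrite //; lia.
Qed.

Lemma is_side2 (a c : V) : is_side [set a; c] = (c == ordS a) || (a == ordS c).
Proof.
apply/existsP/orP => [[x]|[/eqP->|/eqP->]]; first 2 last.
- by exists c; rewrite setUC.
- rewrite set2_eq => /orP[]/andP[/eqP-> /eqP->]; rewrite eqxx; by [left|right].
- by exists a.
Qed.

Lemma side_no_ccw4 (a b c d : V) : is_side [set a; c] -> ~~ ccw4 a b c d.
Proof.
rewrite is_side2 !eq_ord /ccw4 /ccw.
have := ordSP a; have := ordSP c; move: (ordS a : nat) (ordS c : nat).
have := ltn_ord a; have := ltn_ord b; have := ltn_ord c; have := ltn_ord d.
lia.
Qed.

Lemma not_side_ccw4 (a c : V) : a != c -> ~~ is_side [set a; c] ->
  ccw4 a (ordS a) c (ordS c).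
Proof.
rewrite is_side2 !eq_ord /ccw4 /ccw.
have := ordSP a; have := ordSP c; move: (ordS a : nat) (ordS c : nat).
have := ltn_ord a; have := ltn_ord c.
lia.
Qed.

(** * Triangulations and their triangles *)

Lemma is_diagonal2 (a c : V) :
  is_diagonal [set a; c] = (a != c) && ~~ is_side [set a; c].
Proof. by rewrite /is_diagonal cards2; case: (a != c). Qed.

Lemma crossing2 (a b c d : V) :
  crossing [set a; c] [set b; d] = ccw4 a b c d || ccw4 a d c b.
Proof.
apply/idP/orP => [|H].
- move=> /existsP[a' /existsP[b' /existsP[c' /existsP[d' /and3P[H]]]]].
  rewrite !set2_eq => /orP[]/andP[/eqP-> /eqP->] /orP[]/andP[/eqP-> /eqP->];
    by move: H; rewrite /ccw4 /ccw; lia.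
- case: H => H; apply/existsP; exists a; apply/existsP; [exists b|exists d];
    apply/existsP; exists c; apply/existsP; [exists d|exists b];
    by rewrite H !set2_eq !eqxx ?orbT.
Qed.

(** The sides belong to every triangulation as far as triangles and exchange
    relations are concerned, so they are put on the same footing as the diagonals. *)
Definition edge (T : {set {set V}}) (e : {set V}) := is_side e || (e \in T).
Notation ed T a b := (edge T [set a; b]).

Lemma edC T (a b : V) : ed T a b = ed T b a.
Proof. by rewrite setUC. Qed.

Lemma edgeP T (e : {set V}) : triangulation T -> edge T e -> exists a b, a != b /\ e = [set a; b].
Proof.
move=> /maxsetP[/andP[/forall_inP dT _] _] /orP[/existsP[a /eqP->]|/dT /andP[/cards2P[a [b [ab ->]]] _]].
- exists a, (ordS a); split=> //; rewrite eq_ord.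
  by have := ordSP a; lia.
- by exists a, b.
Qed.

Lemma diagonalP (e : {set V}) : is_diagonal (n := n) e ->
  exists a b, [/\ a != b, ~~ is_side [set a; b] & e = [set a; b]].
Proof. by case/andP=> /cards2P[a [b [ab ->]]] ns; exists a, b. Qed.

Lemma triangulation_diag T e : triangulation T -> e \in T -> is_diagonal (n := n) e.
Proof. by move=> /maxsetP[/andP[/forall_inP dT _] _] /dT. Qed.

Lemma diagonal_neq T (a c : V) : triangulation T -> [set a; c] \in T ->
  a != c /\ ~~ is_side [set a; c].
Proof. by move=> tT /(triangulation_diag tT); rewrite is_diagonal2 => /andP. Qed.

Lemma noncross T (a b c d : V) : triangulation T ->
  ed T a c -> ed T b d -> ccw4 a b c d -> False.
Proof.
move=> /maxsetP[/andP[_ /forall_inP nc] _] /orP[s _|acT].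
  by apply/negP; apply: side_no_ccw4.
case/orP=> [s|bdT].
  by rewrite -ccw4_rot; apply/negP; apply: side_no_ccw4.
by have /forall_inP/(_ _ bdT) := nc _ acT; rewrite crossing2 => /norP[/negP].
Qed.

Lemma crossing_diag (a c : V) f : crossing (n := n) [set a; c] f ->
  exists b d, f = [set b; d] /\ ccw4 a b c d.
Proof.
move=> cr; have [b [d fE]] : exists b d, f = [set b; d].
  by move: cr => /existsP[? /existsP[b /existsP[? /existsP[d /and3P[_ _ /eqP->]]]]]; exists b, d.
move: cr; rewrite fE crossing2 => /orP[]; first by exists b, d.
by exists d, b; rewrite setUC.
Qed.

(** Maximality, read on pairs of vertices: a chord that crosses nothing in T can be
    added to T, hence is already there, or is a side. *)
Lemma triangulation_max T (a c : V) : triangulation T -> a != c ->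
  (forall b d, [set b; d] \in T -> ~~ ccw4 a b c d) -> ed T a c.
Proof.
move=> tT ac H; rewrite /edge; have [//|/= ns] := boolP (is_side [set a; c]).
have ncac f : f \in T -> crossing [set a; c] f = false /\ crossing f [set a; c] = false.
  move=> fT; have [b [d [bd _ fE]]] := diagonalP (triangulation_diag tT fT).
  rewrite {f}fE in fT *; have dbT : [set d; b] \in T by rewrite setUC.
  by move: (H _ _ fT) (H _ _ dbT); rewrite !crossing2 /ccw4 /ccw; split; lia.
have self : crossing [set a; c] [set a; c] = false.
  by apply/negbTE; rewrite crossing2 /ccw4 /ccw; lia.
move: tT => /maxsetP[/andP[/forall_inP dT /forall_inP nc]] /(_ ([set a; c] |: T)) <-.
- by rewrite setU11.
- apply/andP; split; apply/forall_inP => e /setU1P[->|eT]; rewrite ?is_diagonal2 ?ac ?ns ?dT //.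
  + by apply/forall_inP => f /setU1P[->|/ncac[->]]; rewrite ?self.
  + apply/forall_inP => f /setU1P[->|fT]; first by case: (ncac _ eT) => _ ->.
    by move/forall_inP: (nc _ eT); apply.
- exact: subsetUr.
Qed.

Lemma triangulation_intro T :
  (forall e, e \in T -> is_diagonal (n := n) e) ->
  (forall a b c d : V, [set a; c] \in T -> [set b; d] \in T -> ~~ ccw4 a b c d) ->
  (forall a c : V, a != c -> ~~ is_side [set a; c] ->
     (forall b d, [set b; d] \in T -> ~~ ccw4 a b c d) -> [set a; c] \in T) ->
  triangulation T.
Proof.
move=> dT nc mx; apply/maxsetP; split.
  apply/andP; split; first by apply/forall_inP.
  apply/forall_inP => e eT; apply/forall_inP => f fT; apply/negP => cr.
  have [a [c [_ _ eE]]] := diagonalP (dT _ eT); rewrite {}eE in eT cr.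
  have [b [d [fE H]]] := crossing_diag cr.
  by move: H; apply/negP; apply: nc; rewrite // -fE.
move=> B /andP[/forall_inP dB /forall_inP ncB] TB; apply/eqP.
rewrite eqEsubset TB andbT; apply/subsetP => e eB.
have [a [c [ac ns eE]]] := diagonalP (dB _ eB).
rewrite eE; apply: mx => // b d /(subsetP TB) bdB; rewrite eE in eB.
by move/forall_inP/(_ _ bdB): (ncB _ eB); rewrite crossing2 => /norP[].
Qed.

(** Counted in counterclockwise steps from a fixed vertex, the cyclic order of the other
    vertices becomes a linear order. *)
Definition dist (a b : V) := if (a <= b)%N then (b - a)%N else (b + n.+3 - a)%N.

Lemma dist_eq0 (a b : V) : (dist a b == 0)%N = (b == a).
Proof.
rewrite eq_ord /dist; have := ltn_ord a; case: (leqP a b); lia.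
Qed.

Lemma dist_inj (a : V) : injective (dist a).
Proof.
move=> b c; rewrite /dist => H; apply/val_inj => /=.
have := ltn_ord a; have := ltn_ord b; have := ltn_ord c.
move: H; case: (leqP a b); case: (leqP a c); lia.
Qed.

Lemma ccw_dist (a x y z : V) : ccw x y z =
  [|| (dist a x < dist a y < dist a z)%N, (dist a y < dist a z < dist a x)%N
    | (dist a z < dist a x < dist a y)%N].
Proof.
rewrite /dist /ccw.
have := ltn_ord a; have := ltn_ord x; have := ltn_ord y; have := ltn_ord z.
case: (leqP a x); case: (leqP a y); case: (leqP a z); lia.
Qed.

Lemma dist0 (a : V) : dist a a = 0%N.
Proof. by apply/eqP; rewrite dist_eq0. Qed.

(** A chord that crosses [a, c] and has its end e on the side of b would cross [a, b] or
    [b, c] if e were not b. *)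
Lemma ccw4_between (a b c e f : V) : ccw a b c -> ccw4 a e c f ->
  ~ ccw4 a e b f -> ~ ccw4 b e c f -> e = b.
Proof.
move=> abc aecf n1 n2; apply/(@dist_inj a).
move: abc aecf n1 n2; rewrite /ccw4 !(ccw_dist a) dist0.
move: (dist a b) (dist a c) (dist a e) (dist a f) => b' c' e' f' {a b c e f}.
case: (ltngtP e' b') => // H H1 H2 H3; [case: H3|case]; lia.
Qed.

(** Every edge bounds a triangle on each side where there is a vertex left.  The apex
    is the last vertex b before c joined to a: a diagonal of T that crosses [b, c]
    cannot cross [a, c] or [a, b], so it ends at a and contradicts the choice of b. *)
Lemma third_vertex T (a c w : V) : triangulation T -> ed T a c -> ccw a w c ->
  exists b, [/\ ccw a b c, ed T a b & ed T b c].
Proof.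
move=> tT acE awc.
have h0 : ccw a (ordS a) c && ed T a (ordS a).
  rewrite /edge is_side2 eqxx andbT.
  move: awc; rewrite /ccw; have := ordSP a; have := ltn_ord a; have := ltn_ord c.
  have := ltn_ord w; lia.
case: (@arg_maxnP _ _ (fun b => ccw a b c && ed T a b) (dist a) h0).
move=> b /andP[abc abE] bmax; exists b; split=> //.
have [_ bc _] := ccw_neq abc; apply: triangulation_max => // e f efT.
apply/negP => X; have efE : ed T e f by rewrite /edge efT orbT.
have feE : ed T f e by rewrite edC.
have H1 : ~ ccw4 a e c f by move=> /(noncross tT acE efE).
have H2 : ~ ccw4 a f b e by move=> /(noncross tT abE feE).
have fa : f = a.
  apply: (@ccw4_between c a b f e) => //; first by rewrite -ccw_rot.
    by rewrite ccw4_rot2.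
  by rewrite ccw4_rot2.
rewrite {}fa in efE feE X H1 H2 efT *.
have ce : ccw a e c && (dist a b < dist a e)%N.
  move: X; clear -abc => /andP[]; move: abc.
  rewrite !(ccw_dist a) dist0; move: (dist a b) (dist a c) (dist a e) => b' c' e'; lia.
have /andP[aec] := ce; rewrite ltnNge => /negP; apply; apply: bmax.
by rewrite aec.
Qed.

(** The quadrilateral formed by the two triangles of T on its diagonal [a, c]. *)
Definition quad T (a b c d : V) :=
  [/\ ccw4 a b c d, [set a; c] \in T, ed T a b /\ ed T b c & ed T c d /\ ed T d a].

Lemma quad_exists T (a c : V) : triangulation T -> [set a; c] \in T ->
  exists b d, quad T a b c d.
Proof.
move=> tT acT; have acE : ed T a c by rewrite /edge acT orbT.
have [ac ns] := diagonal_neq tT acT.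
have /andP[H1 H2] := not_side_ccw4 ac ns.
have [b [Hb abE bcE]] := third_vertex tT acE H1.
have [d [Hd cdE daE]] : exists b, [/\ ccw c b a, ed T c b & ed T b a].
  by apply: (@third_vertex T _ _ (ordS c)); rewrite // 1?edC // ccw_rot.
exists b, d; split=> //; rewrite /ccw4 Hb /=.
by rewrite -ccw_rot ccw_rot -ccw_rot.
Qed.

Definition flipset (T : {set {set V}}) (a b c d : V) : {set {set V}} :=
  [set b; d] |: (T :\ [set a; c]).

(** A diagonal of T that separates b from d stays inside the quadrilateral, since it
    cannot cross its four sides. *)
Lemma quad_cross T (a b c d e f : V) : triangulation T -> quad T a b c d ->
  [set e; f] \in T -> ccw4 b e d f -> [set e; f] = [set a; c].
Proof.
move=> tT [Q acT [ab bc] [cd da]] efT X.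
have efE : ed T e f by rewrite /edge efT orbT.
have feE : ed T f e by rewrite edC.
have H1 : ~ ccw4 b e c f by move=> /(noncross tT bc efE).
have H2 : ~ ccw4 c e d f by move=> /(noncross tT cd efE).
have H3 : ~ ccw4 d f a e by move=> /(noncross tT da feE).
have H4 : ~ ccw4 a f b e by move=> /(noncross tT ab feE).
have /andP[abc acd] := Q; have [bcd dab] : ccw b c d /\ ccw d a b.
  by clear -Q; split; move: Q; rewrite /ccw4 /ccw; lia.
have -> : e = c by apply: (@ccw4_between b c d e f).
have -> : f = a by apply: (@ccw4_between d a b f e); rewrite // ccw4_rot2.
by rewrite setUC.
Qed.

(** The same argument with the roles of the two diagonals of the quadrilateral
    exchanged, but for a chord that need not belong to T. *)
Lemma quad_cross_only T (a b c d e f : V) : triangulation T -> quad T a b c d ->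
  ccw4 a e c f ->
  (forall x y, [set x; y] \in T -> [set x; y] != [set a; c] -> ~~ ccw4 e x f y) ->
  [set e; f] = [set b; d].
Proof.
move=> tT [Q acT [ab bc] [cd da]] X H.
have HE x y : ed T x y -> [set x; y] != [set a; c] -> ~~ ccw4 e x f y.
  case/orP=> [s _|]; last exact: H.
  by rewrite -ccw4_rot; exact: side_no_ccw4.
have ac : uniq [:: a; b; c; d] := ccw4_uniq Q.
have ne x y : ((x == b) || (y == b) || (x == d) || (y == d)) ->
    [set x; y] != [set a; c].
  rewrite set2_eq; move: ac; rewrite /= !inE !negb_or => /and4P[/and3P[ab' _ ad'] /andP[bc' _] cd' _].
  case/orP=> [/orP[/orP[]|]|] /eqP->;
    by rewrite ?(eq_sym b a) ?(negPf ab') ?(negPf bc') ?(eq_sym d) ?(negPf cd') ?(negPf ad') ?andbF.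
have neqs : [/\ [set a; b] != [set a; c], [set b; c] != [set a; c],
    [set c; d] != [set a; c] & [set d; a] != [set a; c]].
  by split; apply: ne; rewrite eqxx ?orbT.
case: neqs => n1 n2 n3 n4.
have H1 := HE _ _ ab n1; have H2 := HE _ _ bc n2; have H3 := HE _ _ cd n3; have H4 := HE _ _ da n4.
rewrite edC in ab; rewrite edC in bc; rewrite edC in cd; rewrite edC in da.
rewrite setUC in n1; rewrite setUC in n2; rewrite setUC in n3; rewrite setUC in n4.
have K1 := HE _ _ ab n1; have K2 := HE _ _ bc n2; have K3 := HE _ _ cd n3; have K4 := HE _ _ da n4.
have /andP[abc acd] := Q.
have -> : e = b by apply: (@ccw4_between a b c e f); rewrite // -ccw4_rot; apply/negP.
have -> : f = d; last by [].
apply: (@ccw4_between c d a f e).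
- by rewrite ccw_rot.
- by rewrite ccw4_rot2.
- by rewrite ccw4_rot; apply/negP.
- by rewrite ccw4_rot; apply/negP.
Qed.

End Polygon.

(** * Flips *)

Section Flips.
Variable n : nat.
Notation V := 'I_n.+3.
Implicit Types (T : {set {set V}}).
Notation ed T a b := (edge T [set a; b]).

Lemma quad_sides_neq (a b c d : V) : ccw4 a b c d ->
  [/\ [set a; b] != [set a; c], [set b; c] != [set a; c],
      [set c; d] != [set a; c] & [set d; a] != [set a; c]].
Proof.
rewrite !set2_eq !eq_ord /ccw4 /ccw.
by move: (a : nat) (b : nat) (c : nat) (d : nat) => {}a {}b {}c {}d H; split; lia.
Qed.

Lemma ccw4_neq (a b c d : V) : ccw4 a b c d -> b != d.
Proof. rewrite eq_ord /ccw4 /ccw; lia. Qed.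

(** A chord outside T crosses something in T by maximality, so here it crosses
    [a, c], and the quadrilateral leaves only one possibility. *)
Lemma replacement_diagonal T (a b c d e f : V) : triangulation T -> quad T a b c d ->
  e != f -> ~~ is_side [set e; f] -> [set e; f] \notin T ->
  (forall x y, [set x; y] \in T -> [set x; y] != [set a; c] -> ~~ ccw4 e x f y) ->
  [set e; f] = [set b; d].
Proof.
move=> tT Q ef ns nT H; apply/eqP/negPn/negP => ne; case/negP: nT.
have : ed T e f; last by rewrite /edge (negPf ns).
apply: triangulation_max => // x y xyT; apply/negP => X; case/negP: ne; apply/eqP.
have Xac : [set x; y] == [set a; c] by apply: contraLR X => /(H _ _ xyT).
move: Xac; rewrite set2_eq => /orP[]/andP[/eqP xE /eqP yE]; subst x y.
- rewrite setUC; apply: (quad_cross_only tT Q); first by rewrite ccw4_rot.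
  by move=> x y xyT' nxy; rewrite ccw4_rot2; apply: H; rewrite setUC.
- by apply: (quad_cross_only tT Q); first by rewrite -ccw4_rot.
Qed.

Lemma flipset_inv T (a b c d x y : V) :
  [set x; y] \in flipset T a b c d ->
  [set x; y] = [set b; d] \/ [set x; y] != [set a; c] /\ [set x; y] \in T.
Proof. by rewrite !inE => /orP[/eqP|/andP[]]; [left|right]. Qed.

Lemma mem_flipset T a b c d (e : {set V}) : e != [set a; c] -> e \in T ->
  e \in flipset T a b c d.
Proof. by move=> ne eT; rewrite !inE ne eT orbT. Qed.

Lemma flip_diag (a b c d : V) : ccw4 a b c d -> is_diagonal [set a; c].
Proof.
move=> Q; rewrite is_diagonal2; apply/andP; split; last first.
  by apply/negP => /side_no_ccw4/negP; apply; exact: Q.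
by apply: (@ccw4_neq d a b c); rewrite -ccw4_rot.
Qed.

(** Noncrossing comes from [quad_cross]; maximality holds because a chord that could
    still be added crosses at most [a, c] in T, which forces it to be [b, d]. *)
Lemma triangulation_flip T (a b c d : V) : triangulation T -> quad T a b c d ->
  triangulation (flipset T a b c d).
Proof.
move=> tT Q; have Q4 : ccw4 a b c d by case: Q.
have acT : [set a; c] \in T by case: Q.
have bd : is_diagonal [set b; d] by apply: (@flip_diag b c d a); rewrite ccw4_rot.
have ed_in e : e \in T -> edge T e by move=> eT; rewrite /edge eT orbT.
apply: triangulation_intro.
- move=> e; rewrite !inE => /orP[/eqP->//|/andP[_]]; exact: triangulation_diag.
- have bdX e f : [set e; f] != [set a; c] -> [set e; f] \in T -> ~~ ccw4 b e d f.
    move=> ne efT; apply: contra ne => X; apply/eqP.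
    exact: (quad_cross tT Q efT X).
  move=> e x f y /flipset_inv[efE|[nef efT]] /flipset_inv[xyE|[nxy xyT]].
  + move/eqP: efE; move/eqP: xyE; rewrite !set2_eq.
    by case/orP=> /andP[/eqP-> /eqP->] /orP[]/andP[/eqP-> /eqP->];
      rewrite /ccw4 /ccw; lia.
  + move/eqP: efE; rewrite set2_eq => /orP[]/andP[/eqP-> /eqP->].
      exact: bdX.
    by rewrite -ccw4_rot2; apply: bdX; rewrite setUC.
  + move/eqP: xyE; rewrite set2_eq => /orP[]/andP[/eqP-> /eqP->].
      by rewrite -ccw4_rot; apply: bdX; rewrite setUC.
    by rewrite ccw4_rot; apply: bdX.
  + by apply/negP; apply: (noncross tT); apply: ed_in.
- move=> e f ef ns H; apply/negPn/negP => nT'.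
  have nbd : [set e; f] != [set b; d] by apply: contraNneq nT' => ->; rewrite !inE eqxx.
  case/negP: nbd; apply/eqP; apply: (replacement_diagonal tT Q) => //.
    apply/negP => efT; case/negP: nT'; apply: mem_flipset => //.
    apply: contraTneq Q4 => /eqP.
    have bdT' : [set b; d] \in flipset T a b c d by rewrite !inE eqxx.
    have dbT' : [set d; b] \in flipset T a b c d by rewrite setUC.
    rewrite set2_eq => /orP[]/andP[/eqP<- /eqP<-]; first exact: H bdT'.
    by rewrite ccw4_rot2; exact: H dbT'.
  by move=> x y xyT nxy; apply: H; apply: mem_flipset.
Qed.

Lemma edge_flipset T a b c d (e : {set V}) : e != [set a; c] -> edge T e ->
  edge (flipset T a b c d) e.
Proof.
by move=> ne /orP[s|eT]; rewrite /edge ?s //; apply/orP; right; apply: mem_flipset.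
Qed.

Lemma quad_flip T (a b c d : V) : quad T a b c d -> quad (flipset T a b c d) b c d a.
Proof.
move=> [Q acT [ab bc] [cd da]]; have [n1 n2 n3 n4] := quad_sides_neq Q.
split; rewrite 1?ccw4_rot //; first by rewrite !inE eqxx.
all: by split; apply: edge_flipset.
Qed.

(** This makes the labels followed along mutations well defined: [flip] only asks that
    the new set be a triangulation. *)
Lemma flip_unique T (a b c d : V) (g : {set V}) : triangulation T -> quad T a b c d ->
  g != [set a; c] -> triangulation (g |: (T :\ [set a; c])) -> g = [set b; d].
Proof.
move=> tT Q ng tT'.
have acT : [set a; c] \in T by case: Q.
have ed_in e : e \in T -> edge T e by move=> eT; rewrite /edge eT orbT.
have [e [f [ef ns gE]]] : exists e f, [/\ e != f, ~~ is_side [set e; f] & g = [set e; f]].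
  by apply: diagonalP; apply: (triangulation_diag tT'); rewrite !inE eqxx.
rewrite gE; apply: (replacement_diagonal tT Q) => //.
  rewrite -gE; apply/negP => gT; have [ac nsac] := diagonal_neq tT acT.
  have : ed (g |: (T :\ [set a; c])) a c.
    apply: triangulation_max => // x y xyT'; apply/negP.
    apply: (noncross tT); apply: ed_in => //.
    by move: xyT'; rewrite !inE => /orP[/eqP->|/andP[]].
  by rewrite /edge (negPf nsac) /= !inE eqxx eq_sym (negPf ng).
move=> x y xyT nxy; apply/negP; apply: (noncross tT'); rewrite /edge -?gE !inE ?eqxx ?orbT //.
by rewrite nxy xyT !orbT.
Qed.

Lemma third_vertex_unique T (a b b' c : V) : triangulation T -> ccw a b c -> ccw a b' c ->
  ed T a b -> ed T b c -> ed T a b' -> ed T b' c -> b = b'.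
Proof.
move=> tT H H' ab bc ab' bc'.
have N1 : ~ ccw4 a b' b c by apply: (noncross tT).
have N2 : ~ ccw4 a b b' c by apply: (noncross tT).
apply/val_inj => /=; clear -H H' N1 N2; move: H H' N1 N2; rewrite /ccw4 /ccw.
lia.
Qed.

(** If v is not joined to w, let b be the last neighbour of v before w and (v, b, x)
    the triangle on the other side of [b, v].  Then [b, x] separates v from w, so it
    is a diagonal, and flipping it creates a new edge at v. *)
Lemma star_or_quad T (v : V) : triangulation T ->
  (forall w, w != v -> ed T v w) \/
  exists a b c, quad T a b c v.
Proof.
move=> tT; have [/forallP H|/forallPn[w]] := boolP [forall w, (w != v) ==> ed T v w].
  by left=> w; apply/implyP.
rewrite negb_imply => /andP[wv nvw]; right.
have h0 : (0 < dist v (ordS v) < dist v w)%N && ed T v (ordS v).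
  apply/andP; split; last by rewrite /edge is_side2 eqxx.
  have wS : w != ordS v by apply: contraNneq nvw => ->; rewrite /edge is_side2 eqxx.
  move: wS wv; rewrite !eq_ord /dist; have := ordSP v; have := ltn_ord v.
  have := ltn_ord w; move: (nat_of_ord (ordS v)) => s.
  case: (leqP v w); case: (leqP v s); lia.
case: (@arg_maxnP _ _ (fun b => (0 < dist v b < dist v w)%N && ed T v b) (dist v) h0).
move=> b /andP[/andP[b0 bw] vb] bmax.
have bwv : ccw b w v by rewrite (ccw_dist v) dist0; lia.
rewrite edC in vb.
have [x [bxv bx xv]] := third_vertex tT vb bwv.
have xw : x != w by apply: contraNneq nvw => <-; rewrite edC.
have wx : (dist v w < dist v x)%N.
  rewrite ltn_neqAle (inj_eq (@dist_inj _ v)) eq_sym xw /= leqNgt; apply/negP => xw'.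
  move: (bmax x); rewrite edC xv xw' !andbT => {}bmax.
  move: bmax bxv; rewrite (ccw_dist v) dist0 => bmax bxv.
  move: bmax bxv b0 bw xw'; clear.
  move: (dist v b) (dist v w) (dist v x) => b' w' x' H0 H1 H2 H3 H4.
  by have := H0 ltac:(lia); lia.
have [bwx bwxv] : ccw b w x /\ ccw4 b w x v.
  move: b0 bw wx; rewrite /ccw4 !(ccw_dist v) dist0; clear.
  by move: (dist v b) (dist v w) (dist v x) => b' w' x'; split; lia.
have [c [bcx bc cx]] := third_vertex tT bx bwx.
exists b, c, x; split=> //; last by split; rewrite // edC.
  by rewrite /ccw4 bcx.
by case/orP: bx => // /side_no_ccw4 s; case/negP: (s w v).
Qed.

(** Connectedness of the flip graph in the form of an induction principle: each flip
    given by [star_or_quad] adds a neighbour of v, and stops at the star of v. *)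
Lemma flip_induction (v : V) (P : {set {set V}} -> Prop) :
  (forall T, triangulation T -> (forall w, w != v -> ed T v w) -> P T) ->
  (forall T a b c d, triangulation T -> quad T a b c d ->
     P (flipset T a b c d) -> P T) ->
  forall T, triangulation T -> P T.
Proof.
move=> base step T tT.
move: {2}_.+1 (ltnSn #|[set w | ~~ ed T v w]|) => m.
elim: m T tT => // m IH T tT; rewrite ltnS => le_m.
have [star|[a [b [c Q]]]] := star_or_quad v tT; first exact: base.
apply: (step T a b c v tT Q); apply: IH; first exact: triangulation_flip.
apply: leq_trans le_m; apply: proper_card; apply/properP; split.
  apply/subsetP => w; rewrite !inE; apply: contra; apply: edge_flipset.
  have := ccw4_uniq (a := a) (b := b) (c := c) (d := v).
  case: Q => -> _ _ _ /(_ isT); rewrite /= !inE !negb_or.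
  move=> /and4P[/and3P[_ _ av] _ cv _].
  by rewrite set2_eq ![v == _]eq_sym (negPf av) (negPf cv).
exists b; rewrite !inE; last by rewrite /edge setUC !inE eqxx orbT.
apply/negP => vb; case: Q => Q acT _ _.
by apply: (noncross tT _ _ Q); rewrite ?[ed T b v]edC // /edge acT orbT.
Qed.

End Flips.

(** * The exchange matrix of a triangulation *)

Section ExchangeMatrix.
Variable n : nat.
Notation V := 'I_n.+3.
Implicit Types (T : {set {set V}}).
Notation ed T a b := (edge T [set a; b]).

Definition tri T (a b c : V) := [&& ccw a b c, ed T a b, ed T b c & ed T c a].

(** The positive entries of B(T): running counterclockwise around some triangle, e comes
    right after f. *)
Definition tri_arrow T (e f : {set V}) :=
  [exists a, exists b, exists c,
     [&& tri T a b c, e == [set a; b] & f == [set a; c]]].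

(** The matrix B(T) with rows and columns for the sides as well.  The extra rows
    record the coefficients, so that matrix mutation and coefficient mutation are one
    and the same rule. *)
Definition tri_matrix T (e f : {set V}) : int :=
  (tri_arrow T e f)%:Z - (tri_arrow T f e)%:Z.

Lemma tri_arrowP T e f :
  reflect (exists a b c, [/\ tri T a b c, e = [set a; b] & f = [set a; c]])
          (tri_arrow T e f).
Proof.
apply: (iffP existsP) => [[a /existsP[b /existsP[c /and3P[t /eqP-> /eqP->]]]]|].
  by exists a, b, c.
by move=> [a [b [c [t -> ->]]]]; exists a; apply/existsP; exists b; apply/existsP;
  exists c; rewrite t !eqxx.
Qed.

Lemma tri_rot T (a b c : V) : tri T b c a = tri T a b c.
Proof. by rewrite /tri ccw_rot; do !case: (edge _ _); case: ccw. Qed.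

Lemma quad_tri T (a b c d : V) : quad T a b c d -> tri T a b c /\ tri T a c d.
Proof.
move=> [/andP[abc acd] acT [ab bc] [cd da]]; have acE : ed T a c by rewrite /edge acT orbT.
by rewrite /tri abc acd ab bc cd da ![ed T c a]edC acE.
Qed.

Lemma quad_sym T (a b c d : V) : quad T a b c d -> quad T c d a b.
Proof. by move=> [Q acT [ab bc] [cd da]]; split; rewrite // 1?ccw4_rot2 // setUC. Qed.

Lemma quad_third_vertex T (a b c d x : V) : triangulation T -> quad T a b c d ->
  tri T a x c -> x = b.
Proof.
move=> tT Q /and4P[axc ax xc _]; case: (quad_tri Q) => /and4P[abc ab bc _] _.
exact: (third_vertex_unique tT axc abc).
Qed.

(** Leaving out the triangles with third edge k gives a part of [tri_arrow] that can be
    compared before and after a flip of k. *)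
Definition arrow_off T (k e f : {set V}) :=
  [exists a, exists b, exists c,
     [&& tri T a b c, e == [set a; b], f == [set a; c] & [set b; c] != k]].

Lemma arrow_offP T k e f :
  reflect (exists a b c, [/\ tri T a b c, e = [set a; b], f = [set a; c] & [set b; c] != k])
          (arrow_off T k e f).
Proof.
apply: (iffP existsP) => [[a /existsP[b /existsP[c /and4P[t /eqP-> /eqP-> ?]]]]|].
  by exists a, b, c.
by move=> [a [b [c [t -> -> ?]]]]; exists a; apply/existsP; exists b; apply/existsP;
  exists c; rewrite t !eqxx.
Qed.

(** Only the two triangles on [a, c] have third edge [a, c]. *)
Lemma arrow_split T (a b c d : V) e f : triangulation T -> quad T a b c d ->
  tri_arrow T e f = [|| arrow_off T [set a; c] e f,
    (e == [set b; c]) && (f == [set a; b]) | (e == [set d; a]) && (f == [set c; d])].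
Proof.
move=> tT Q; have [t1 t2] := quad_tri Q.
apply/tri_arrowP/idP => [[x [y [z [t eE fE]]]]|].
  have [/eqP|ne] := boolP ([set y; z] == [set a; c]); last first.
    by apply/orP; left; apply/arrow_offP; exists x, y, z.
  move/eqP; rewrite set2_eq => /orP[]/andP[/eqP yE /eqP zE]; subst y z.
    have xE : x = d by apply: (quad_third_vertex tT (quad_sym Q)); rewrite -tri_rot.
    by rewrite eE fE xE [[set d; c]]setUC !eqxx !orbT.
  have xE : x = b by apply: (quad_third_vertex tT Q); rewrite -tri_rot.
  by rewrite eE fE xE [[set b; a]]setUC !eqxx !orbT.
case/or3P=> [/arrow_offP[x [y [z [t -> -> _]]]]|/andP[/eqP-> /eqP->]|/andP[/eqP-> /eqP->]].
- by exists x, y, z.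
- by exists b, c, a; split; rewrite 1?tri_rot // setUC.
- by exists d, a, c; split; rewrite // 1?setUC // -tri_rot.
Qed.

(** Two adjacent edges determine the triangle they bound. *)
Lemma arrow_off_fst T (a b c : V) : uniq [:: a; b; c] ->
  arrow_off T [set a; c] [set b; c] [set a; b] = false.
Proof.
move=> /= /and3P[]; rewrite !inE => /norP[ab ac] bc _.
apply/arrow_offP => [[x [y [z [t]]]]].
have /ccw_neq[xy yz xz] : ccw x y z by case/and4P: t.
move=> /eqP; rewrite set2_eq => /orP[]/andP[/eqP Ex /eqP Ey];
  move=> /eqP; rewrite set2_eq => /orP[]/andP[/eqP Ex' /eqP Ez]; subst;
  rewrite ?eqxx // in ab ac bc xy yz xz *.
by rewrite setUC eqxx.
Qed.

Lemma quad_uniq T (a b c d : V) : quad T a b c d -> uniq [:: a; b; c; d].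
Proof. by case=> /ccw4_uniq. Qed.

Lemma quad_arrow_k T (a b c d : V) e : triangulation T -> quad T a b c d ->
  tri_arrow T e [set a; c] = (e == [set a; b]) || (e == [set c; d]).
Proof.
move=> tT Q; have [t1 t2] := quad_tri Q.
apply/tri_arrowP/orP => [[x [y [z [t eE /eqP]]]]|[/eqP->|/eqP->]].
- rewrite set2_eq => /orP[]/andP[/eqP xE /eqP zE]; subst x z; rewrite eE.
    by left; rewrite (quad_third_vertex tT Q t).
  by right; rewrite (quad_third_vertex tT (quad_sym Q) t).
- by exists a, b, c.
- by exists c, d, a; split; rewrite 1?tri_rot // setUC.
Qed.

Lemma quad_k_arrow T (a b c d : V) e : triangulation T -> quad T a b c d ->
  tri_arrow T [set a; c] e = (e == [set b; c]) || (e == [set d; a]).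
Proof.
move=> tT Q; have [t1 t2] := quad_tri Q.
apply/tri_arrowP/orP => [[x [y [z [t /eqP]]]]|[/eqP->|/eqP->]].
- rewrite set2_eq => /orP[]/andP[/eqP xE /eqP zE] -> ; subst x y.
    right; rewrite [[set d; a]]setUC.
    by rewrite (@quad_third_vertex _ _ _ _ _ z tT (quad_sym Q)) // tri_rot.
  left; rewrite [[set b; c]]setUC.
  by rewrite (@quad_third_vertex _ _ _ _ _ z tT Q) // tri_rot.
- by exists c, a, b; split; rewrite 1?[[set a; c]]setUC 1?[[set c; b]]setUC // -tri_rot.
- by exists a, c, d; split; rewrite // setUC.
Qed.


Lemma quad_notin T (a b c d : V) : triangulation T -> quad T a b c d ->
  edge T [set b; d] = false.
Proof.
move=> tT [Q acT _ _]; apply/negP => bd.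
by apply: (noncross tT _ bd Q); rewrite /edge acT orbT.
Qed.

Lemma flipsetK T (a b c d : V) : triangulation T -> quad T a b c d ->
  flipset (flipset T a b c d) b c d a = T.
Proof.
move=> tT Q; have /norP[_ bdT] := negbT (quad_notin tT Q).
have acT : [set c; a] \in T by rewrite setUC; case: Q.
apply/setP => e; rewrite !inE [[set a; c]]setUC.
have [->|_] := eqVneq e [set c; a]; first by rewrite acT.
by have [->|_] := eqVneq e [set b; d]; first by rewrite (negPf bdT).
Qed.

(** The triangles that a flip does not touch contribute the same entries before and
    after it. *)
Lemma arrow_off_flip T (a b c d : V) e f : triangulation T -> quad T a b c d ->
  e != [set a; c] -> f != [set a; c] -> e != [set b; d] -> f != [set b; d] ->
  arrow_off (flipset T a b c d) [set b; d] e f = arrow_off T [set a; c] e f.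
Proof.
have imp T' (a' b' c' d' : V) : triangulation T' -> quad T' a' b' c' d' ->
  e != [set a'; c'] -> f != [set a'; c'] ->
  arrow_off T' [set a'; c'] e f -> arrow_off (flipset T' a' b' c' d') [set b'; d'] e f.
  move=> tT Q ea fa /arrow_offP[x [y [z [/and4P[xyz xy yz zx] eE fE ne]]]].
  apply/arrow_offP; exists x, y, z; split=> //.
    rewrite /tri xyz !edge_flipset // -?eE // setUC -fE //.
  by apply: contraTneq yz => ->; rewrite (quad_notin tT Q).
move=> tT Q ea fa eb fb; apply/idP/idP; last exact: imp.
move=> /(imp _ _ c d a (triangulation_flip tT Q) (quad_flip Q) eb fb).
by rewrite flipsetK // setUC.
Qed.

(** Matrix mutation for the 0/1 indicators of the four sides of a quadrilateral: the
    primed variables belong to the column index, the others to the row index, and o,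
    o' stand for the contribution of the triangles outside the quadrilateral. *)
Lemma sign_flip (ab bc cd da ab' bc' cd' da' o o' : bool) :
  (ab + bc + cd + da <= 1)%N -> (ab' + bc' + cd' + da' <= 1)%N ->
  bc && ab' || da && cd' || ab && da' || cd && bc' ==> ~~ o ->
  bc' && ab || da' && cd || ab' && da || cd' && bc ==> ~~ o' ->
  let alpha : int := (ab || cd)%:Z - (bc || da)%:Z in
  let beta : int := (bc' || da')%:Z - (ab' || cd')%:Z in
  [|| o, cd && bc' | ab && da']%:Z - [|| o', cd' && bc | ab' && da]%:Z =
  [|| o, bc && ab' | da && cd']%:Z - [|| o', bc' && ab | da' && cd]%:Z
   + ((`|alpha| * beta + alpha * `|beta|) %/ 2)%Z :> int.
Proof.
by case: ab bc cd da => [] [] [] [] //; case: ab' bc' cd' da' => [] [] [] [] //;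
  case: o o' => [] [].
Qed.

Lemma quad_excl (T : {set {set V}}) (a b c d : V) (e : {set V}) : quad T a b c d ->
  ((e == [set a; b]) + (e == [set b; c]) + (e == [set c; d]) + (e == [set d; a]) <= 1)%N.
Proof.
move=> /quad_uniq /= /and4P[]; rewrite !inE => /norP[ab /norP[ac ad]] /norP[bc bd] cd _.
have [->|_] := eqVneq e [set a; b].
  by rewrite !set2_eq (negPf ab) (negPf ac) (negPf ad) (negPf bd) (negPf bc) ?andbF ?orbF.
have [->|_] := eqVneq e [set b; c].
  by rewrite !set2_eq (negPf bc) (negPf bd) (negPf cd) ?(eq_sym c a) ?(negPf ac) ?andbF.
have [->|_] := eqVneq e [set c; d].
  by rewrite !set2_eq (negPf cd) ?(eq_sym c a) ?(negPf ac) ?andbF.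
by case: (_ == _).
Qed.

(** Flips act on B(T) by matrix mutation, here for the entries away from the flipped
    diagonal.  Only the pairs of consecutive sides of the quadrilateral change. *)
Lemma tri_matrix_flip T (a b c d : V) (e f : {set V}) :
  triangulation T -> quad T a b c d ->
  e != [set a; c] -> f != [set a; c] -> e != [set b; d] -> f != [set b; d] ->
  tri_matrix (flipset T a b c d) e f = tri_matrix T e f
   + ((`|tri_matrix T e [set a; c]| * tri_matrix T [set a; c] f
       + tri_matrix T e [set a; c] * `|tri_matrix T [set a; c] f|) %/ 2)%Z.
Proof.
move=> tT Q ea fa eb fb; have tT' := triangulation_flip tT Q; have Q' := quad_flip Q.
have off g h : g != [set a; c] -> h != [set a; c] -> g != [set b; d] -> h != [set b; d] ->
    (g == [set b; c]) && (h == [set a; b]) || (g == [set d; a]) && (h == [set c; d])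
    || (g == [set a; b]) && (h == [set d; a]) || (g == [set c; d]) && (h == [set b; c])
    ==> ~~ arrow_off T [set a; c] g h.
  move=> ga ha gb hb; have /= /and4P[] := quad_uniq Q.
  rewrite !inE => /norP[ab /norP[ac ad]] /norP[bc bd] cd _.
  rewrite eq_sym in ac; rewrite eq_sym in ad; rewrite eq_sym in bd.
  apply/implyP => /orP[/orP[/orP[]|]|] /andP[/eqP gE /eqP hE].
  - by rewrite gE hE arrow_off_fst //= !inE negb_or ab eq_sym ac bc.
  - by rewrite gE hE setUC arrow_off_fst //= !inE negb_or cd ac ad.
  - rewrite -(arrow_off_flip tT Q) // gE hE setUC arrow_off_fst //=.
    by rewrite !inE negb_or ad bd ab.
  - rewrite -(arrow_off_flip tT Q) // gE hE arrow_off_fst //=.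
    by rewrite !inE negb_or bc eq_sym bd cd.
rewrite /tri_matrix !(quad_arrow_k _ tT Q) !(quad_k_arrow _ tT Q).
rewrite !(arrow_split _ _ tT Q) !(arrow_split _ _ tT' Q') !arrow_off_flip //.
by apply: sign_flip; rewrite ?(quad_excl _ Q) // off.
Qed.

Lemma tri_matrix_anti T e f : tri_matrix T f e = - tri_matrix T e f.
Proof. by rewrite /tri_matrix opprB. Qed.

Lemma tri_matrix_col T (a b c d : V) (e : {set V}) : triangulation T -> quad T a b c d ->
  tri_matrix T e [set a; c] =
  ((e == [set a; b]) || (e == [set c; d]))%:Z - ((e == [set b; c]) || (e == [set d; a]))%:Z.
Proof. by move=> tT Q; rewrite /tri_matrix (quad_arrow_k _ tT Q) (quad_k_arrow _ tT Q). Qed.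

Lemma tri_matrix_flip_col T (a b c d : V) (e : {set V}) : triangulation T -> quad T a b c d ->
  tri_matrix (flipset T a b c d) e [set b; d] = - tri_matrix T e [set a; c].
Proof.
move=> tT Q; rewrite (tri_matrix_col _ (triangulation_flip tT Q) (quad_flip Q)).
by rewrite (tri_matrix_col _ tT Q) opprB [(e == [set c; d]) || _]orbC.
Qed.

End ExchangeMatrix.

(** * Minors of a matrix with two rows *)

Section Minors.
Variable n : nat.
Notation V := 'I_n.+3.
Implicit Types (T : {set {set V}}).
Notation ed T a b := (edge T [set a; b]).

Definition plucker_rel (K : pzRingType) (X : {set V} -> K) := forall a b c d : V,
  ccw4 a b c d ->
  X [set a; c] * X [set b; d] =
  X [set a; b] * X [set c; d] + X [set a; d] * X [set b; c].

(** The 2 x 2 minors as a function on sets of vertices: the sum has a single term,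
    which orders the two vertices.  Labelling by sets makes the three-term relation
    invariant under rotation, with no signs for wrapping around the polygon. *)
Definition minor (K : pzRingType) (u v : V -> K) (e : {set V}) : K :=
  \sum_(p : V * V | (p.1 < p.2)%N && (e == [set p.1; p.2]))
    (u p.1 * v p.2 - u p.2 * v p.1).

Lemma minorE (K : pzRingType) (u v : V -> K) (a b : V) : (a < b)%N ->
  minor u v [set a; b] = u a * v b - u b * v a.
Proof.
move=> ab; rewrite /minor (big_pred1 (a, b)) // => -[x y] /=.
rewrite set2_eq xpair_eqE [a == x]eq_sym [b == y]eq_sym [a == y]eq_sym [b == x]eq_sym.
rewrite !eq_ord; lia.
Qed.

Lemma minor_out (K : pzRingType) (u v : V -> K) (e : {set V}) :
  (forall a b : V, (a < b)%N -> e != [set a; b]) -> minor u v e = 0.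
Proof. by move=> H; rewrite /minor big_pred0 // => -[x y] /=; case: ltnP => //= /H /negPf. Qed.

Lemma set2_wlog (P : {set V} -> Prop) :
  (forall a b : V, (a < b)%N -> P [set a; b]) ->
  forall a b : V, a != b -> P [set a; b].
Proof.
move=> H a b; rewrite eq_ord neq_ltn => /orP[/H//|/H]; by rewrite setUC.
Qed.

(** The three-term identity is checked for increasing indices; the other cyclic
    positions are rotations of it. *)
Lemma minor_plucker (K : comPzRingType) (u v : V -> K) : plucker_rel (minor u v).
Proof.
have main (a b c d : V) : (a < b)%N -> (b < c)%N -> (c < d)%N ->
  minor u v [set a; c] * minor u v [set b; d] =
  minor u v [set a; b] * minor u v [set c; d] + minor u v [set a; d] * minor u v [set b; c].
  move=> ab bc cd; rewrite !minorE //; first ring; lia.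
move=> a b c d.
have : ccw4 a b c d -> [|| (a < b < c)%N && (c < d)%N, (b < c < d)%N && (d < a)%N,
     (c < d < a)%N && (a < b)%N | (d < a < b)%N && (b < c)%N].
  rewrite /ccw4 /ccw; lia.
move=> H /H/or4P[] /andP[/andP[h1 h2] h3].
- by rewrite main.
- rewrite [[set a; c]]setUC mulrC (main b c d a) // [[set d; a]]setUC [[set b; a]]setUC.
  by rewrite addrC; congr (_ + _); rewrite mulrC.
- rewrite [[set a; c]]setUC [[set b; d]]setUC (main c d a b) // [[set d; a]]setUC [[set c; b]]setUC.
  by congr (_ + _); rewrite mulrC.
- rewrite mulrC [[set b; d]]setUC (main d a b c) // [[set d; a]]setUC [[set d; c]]setUC addrC.
  by congr (_ + _); rewrite mulrC.
Qed.

(** Solving one exchange relation per flip expresses all coordinates rationally in the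
    edges of T.  From the star of the vertex 0, the coordinates [a, b] are reached by
    induction on b - a, using the relation for 0 < a < b - 1 < b. *)
Lemma edges_generate (K : fieldType) (S : K -> Prop) (X : {set V} -> K) :
  (forall x y, S x -> S y -> S (x + y)) -> (forall x y, S x -> S y -> S (x * y)) ->
  (forall x y, S x -> S y -> S (x / y)) ->
  plucker_rel X -> (forall a b : V, a != b -> X [set a; b] != 0) ->
  forall T, triangulation T -> (forall e, edge T e -> S (X e)) ->
  forall a b : V, a != b -> S (X [set a; b]).
Proof.
move=> SD SM SV plk nz; apply: (flip_induction (v := ord0)).
- move=> T tT star SE; apply: (@set2_wlog (fun e => S (X e))) => a b.
  have [m] := ubnP (b - a)%N; elim: m a b => // m IH a b; rewrite ltnS => le_m ab.
  have [a0|a0] := eqVneq a ord0.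
    by rewrite a0; apply: SE; apply: star; move: ab; rewrite a0 eq_ord -lt0n.
  have [sab|nsab] := boolP (is_side [set a; b]); first by apply: SE; rewrite /edge sab.
  have ltb : (b.-1 < n.+3)%N by have := ltn_ord b; lia.
  (* The relation for 0 < a < b - 1 < b gives [a, b] from [a, b - 1], the side
     [b - 1, b] and edges at 0. *)
  pose c : V := Ordinal ltb.
  have ac : (a < c)%N.
    move: nsab; rewrite is_side2 negb_or => /andP[]; rewrite !eq_ord => + _.
    have := ordSP a; move: (nat_of_ord (ordS a)) ab (ltn_ord b) => i; rewrite /c /=; lia.
  have bc : (c < b)%N by rewrite /=; lia.
  have Sac : S (X [set a; c]) by apply: IH => //; lia.
  have S0 (w : V) : (0 < w)%N -> S (X [set ord0; w]).
    by move=> w0; apply: SE; apply: star; rewrite eq_ord -lt0n.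
  have Scb : S (X [set c; b]).
    apply: SE; rewrite /edge is_side2; apply/orP; left; apply/orP; left.
    rewrite eq_ord; have := ordSP c; have := ltn_ord b; move: (nat_of_ord (ordS c)).
    by rewrite /=; lia.
  have Q : ccw4 ord0 a c b by rewrite /ccw4 /ccw; move: a0; rewrite eq_ord -lt0n /=; lia.
  have c0 : ord0 != c by rewrite eq_ord eq_sym /= -lt0n; move: ac; rewrite /=; lia.
  have -> : X [set a; b] =
      (X [set ord0; a] * X [set c; b] + X [set ord0; b] * X [set a; c]) / X [set ord0; c].
    by rewrite -(plk _ _ _ _ Q) mulrC mulKf // nz.
  have a1 : (0 < a)%N by move: a0; rewrite eq_ord -lt0n.
  apply: SV; last by apply: S0; apply: leq_trans ac.
  by apply: SD; apply: SM => //; apply: S0 => //; apply: ltn_trans ab.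
- move=> T a b c d tT Q IH SE; apply: IH => e.
  have Q4 : ccw4 a b c d by case: Q.
  have [Sab Sbc Scd Sda] : [/\ S (X [set a; b]), S (X [set b; c]), S (X [set c; d]) & S (X [set d; a])].
    by case: Q => _ _ [? ?] [? ?]; split; apply: SE.
  have Sac : S (X [set a; c]) by apply: SE; case: Q => _ acT _ _; rewrite /edge acT orbT.
  have ac : a != c by case/andP: Q4 => /ccw_neq[].
  case/orP=> [s|]; first by apply: SE; rewrite /edge s.
  rewrite !inE => /orP[/eqP->|/andP[_ eT]]; last by apply: SE; rewrite /edge eT orbT.
  have -> : X [set b; d] = (X [set a; b] * X [set c; d] + X [set d; a] * X [set b; c]) / X [set a; c].
    by rewrite [[set d; a]]setUC -(plk _ _ _ _ Q4) mulrC mulKf // nz.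
  by apply: (SV) => //; apply: (SD); apply: (SM).
Qed.

(** The diagonals that avoid the vertex 0 would cross its star. *)
Lemma star_edge T (a b : V) : triangulation T -> (forall w, w != ord0 -> ed T ord0 w) ->
  (a < b)%N -> ed T a b -> a = ord0 \/ b = a.+1 :> nat.
Proof.
move=> tT star ab abT; have [->|a0] := eqVneq a ord0; [by left|right].
have [//|ne] := eqVneq (b : nat) a.+1.
have ltb : (b.-1 < n.+3)%N by have := ltn_ord b; lia.
pose c : V := Ordinal ltb; exfalso.
have c0 : c != ord0 by rewrite eq_ord /= -lt0n; move: ab ne; lia.
apply: (noncross tT (star c c0) abT).
move: a0; rewrite /ccw4 /ccw eq_ord -lt0n /=; lia.
Qed.

(** Positive values can be prescribed freely on the edges of T.  For the star of the
    vertex 0 the matrix is explicit; a flip transports prescribed values by the exchange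
    relation, which preserves positivity and can be solved backwards because no minor
    vanishes. *)
Lemma positive_realization (K : realFieldType) T : triangulation T ->
  forall c : {set V} -> K, (forall e, edge T e -> 0 < c e) ->
  exists u v : V -> K, (forall a b : V, a != b -> 0 < minor u v [set a; b]) /\
    (forall e, edge T e -> minor u v e = c e).
Proof.
move: T; apply: (flip_induction (v := ord0)).
- move=> T tT star c cpos.
  (* With first column (1, 0) the minors with 0 are the entries g of the second row.
     The first row is chosen so that the minor [a, b] is g a * g b * (s b - s a), a
     sum of positive terms that reduces to the value on the side when b = a + 1. *)
  pose g (i : nat) := c [set ord0; (inord i : V)].
  pose h (i : nat) := c [set (inord i : V); (inord i.+1 : V)] / (g i * g i.+1).
  pose s (j : nat) := \sum_(1 <= i < j) h i.
  pose u (j : V) := if j == ord0 then 1 else - (g j * s j).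
  pose v (j : V) := if j == ord0 then 0 else g j.
  have gE (j : V) : g j = c [set ord0; j] by rewrite /g inord_val.
  have gpos (j : nat) : (0 < j < n.+3)%N -> 0 < g j.
    by move=> /andP[j0 jn]; rewrite /g; apply: cpos; apply: star; rewrite eq_ord inordK // -lt0n.
  have hpos (j : nat) : (0 < j)%N -> (j.+1 < n.+3)%N -> 0 < h j.
    move=> j0 jn; rewrite /h divr_gt0 ?mulr_gt0 ?gpos //; try lia.
    apply: cpos; rewrite /edge is_side2 !eq_ord; apply/orP; left; apply/orP; left.
    have := ordSP (inord j : V); move: (nat_of_ord (ordS _)); rewrite !inordK //; lia.
  have m0 (j : V) : (0 < j)%N -> minor u v [set ord0; j] = g j.
    move=> j0; rewrite minorE // /u /v eqxx eq_ord -[X in X == _]/(nat_of_ord j) (negPf (lt0n_neq0 j0)).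
    by rewrite mul1r mulr0 subr0.
  have m1 (a b : V) : (0 < a)%N -> (a < b)%N -> minor u v [set a; b] = g a * g b * (\sum_(a <= i < b) h i).
    move=> a0 ab; rewrite minorE // /u /v !eq_ord (negPf (lt0n_neq0 a0)).
    rewrite (negPf (lt0n_neq0 (ltn_trans a0 ab))) /s.
    rewrite (big_cat_nat (n := a) (p := b)) //=; last exact: ltnW.
    by ring.
  exists u, v; split.
    apply: (@set2_wlog (fun e => 0 < minor u v e)) => a b ab; have [->|a0] := eqVneq a ord0.
      by rewrite m0 ?gpos //=; have := ltn_ord b; lia.
    rewrite eq_ord -lt0n in a0.
    have gab : 0 < g a * g b by rewrite mulr_gt0 ?gpos //; have := ltn_ord a; have := ltn_ord b; lia.
    rewrite m1 // mulr_gt0 //.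
    rewrite big_ltn // ltr_wpDr ?hpos //; last by have := ltn_ord b; lia.
    rewrite big_nat; apply: sumr_ge0 => i /andP[ai ib]; apply/ltW/hpos; first lia.
    by have := ltn_ord b; lia.
  move=> e eT; have [a0 [b0 [ab0 eE]]] := edgeP tT eT; rewrite {}eE in eT *.
  move: a0 b0 ab0 eT; apply: (@set2_wlog (fun e => edge T e -> minor u v e = c e)) => a b ab abT.
  have [a0|bE] := star_edge tT star ab abT.
    by rewrite a0 m0 // -?gE //; move: ab; rewrite a0 /=.
  have [a0|a0] := eqVneq a ord0.
    by rewrite a0 m0 // -?gE //; move: ab; rewrite a0 /=.
  rewrite eq_ord -lt0n in a0.
  rewrite m1 // bE big_nat1 /h -bE !inord_val mulrC divfK //.
  by apply: lt0r_neq0; rewrite mulr_gt0 ?gpos //; have := ltn_ord a; have := ltn_ord b; lia.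
- move=> T a b c d tT Q IH w wpos.
  have Q4 : ccw4 a b c d by case: Q.
  have acE : ed T a c by case: Q => _ acT _ _; rewrite /edge acT orbT.
  have [abE bcE cdE daE] : [/\ ed T a b, ed T b c, ed T c d & ed T d a] by case: Q => _ _ [? ?] [? ?].
  pose k := (w [set a; b] * w [set c; d] + w [set d; a] * w [set b; c]) / w [set a; c].
  have kpos : 0 < k by rewrite divr_gt0 ?addr_gt0 ?mulr_gt0 ?wpos.
  (* w' is the value prescribed on the flipped triangulation; the exchange relation then
     gives back w on the diagonal that was removed. *)
  pose w' e := if e == [set b; d] then k else w e.
  have w'E e : edge T e -> w' e = w e.
    by rewrite /w'; case: eqP => // ->; rewrite (quad_notin tT Q).
  have [|u [v [pos uv]]] := IH w'.
    move=> e; rewrite /w'; case: eqP => // ne /orP[s|]; first by rewrite wpos // /edge s.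
    by rewrite !inE => /orP[/eqP//|/andP[_ eT]]; rewrite wpos // /edge eT orbT.
  exists u, v; split=> // e eT; have [eac|eac] := eqVneq e [set a; c]; last first.
    by rewrite uv ?w'E //; apply: edge_flipset.
  have [n1 n2 n3 n4] := quad_sides_neq Q4.
  have := minor_plucker u v Q4.
  have bdE : edge (flipset T a b c d) [set b; d] by rewrite /edge !inE eqxx orbT.
  rewrite [[set a; d]]setUC (uv _ bdE) (uv [set a; b]) ?(uv [set b; c])
    ?(uv [set c; d]) ?(uv [set d; a]); try exact: edge_flipset.
  rewrite [w' [set b; d]]/w' eqxx !w'E // -eac => H.
  have : minor u v e * k = w e * k by rewrite H /k -eac [RHS]mulrC divfK // lt0r_neq0 // wpos.
  by apply: mulIf; apply: lt0r_neq0.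
Qed.
End Minors.

(** * Rings generated by families with the same relations *)

(** Integer polynomial expressions.  They can be evaluated in rings that may be
    trivial, such as the generated subrings, and evaluation commutes with morphisms. *)
Inductive rterm (I : Type) :=
| RVar of I | ROne | RSub of rterm I & rterm I | RMul of rterm I & rterm I.
Arguments ROne {I}.

Section SubringGenVal.
Variables (A : comPzRingType) (S : A -> Prop).
Lemma subring_gen_valB (a b : subring_gen S) : val (a - b) = val a - val b.
Proof. exact: (rmorphB (val : {rmorphism subring_gen S -> A})). Qed.
Lemma subring_gen_valM (a b : subring_gen S) : val (a * b) = val a * val b.
Proof. exact: (rmorphM (val : {rmorphism subring_gen S -> A})). Qed.
Lemma subring_gen_val1 : val (1 : subring_gen S) = 1.
Proof. exact: (rmorph1 (val : {rmorphism subring_gen S -> A})). Qed.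
End SubringGenVal.

Section Terms.
Variable I : Type.

Fixpoint evalT (A : pzRingType) (x : I -> A) (t : rterm I) : A :=
  match t with
  | RVar i => x i
  | ROne => 1
  | RSub t u => evalT x t - evalT x u
  | RMul t u => evalT x t * evalT x u
  end.

Lemma evalT_morph (A B : pzRingType) (f : A -> B) (x : I -> A) t :
  zmod_morphism f -> monoid_morphism f -> f (evalT x t) = evalT (f \o x) t.
Proof. by move=> fB [f1 fM]; elim: t => //= t1 <- t2 <-; rewrite ?fB ?fM. Qed.

Lemma evalT_rmorph (A B : pzRingType) (f : {rmorphism A -> B}) (x : I -> A) t :
  f (evalT x t) = evalT (f \o x) t.
Proof. by apply: evalT_morph; [exact: rmorphB | split; [exact: rmorph1 | exact: rmorphM]]. Qed.

Lemma evalT_val (A : comPzRingType) (S : A -> Prop) (x : I -> subring_gen S) t :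
  val (evalT x t) = evalT (val \o x) t.
Proof.
apply: evalT_morph; first exact: subring_gen_valB.
by split; [exact: subring_gen_val1 | exact: subring_gen_valM].
Qed.

Lemma eq_evalT (A : pzRingType) (x y : I -> A) t : x =1 y -> evalT x t = evalT y t.
Proof. by move=> xy; elim: t => //= t1 -> t2 ->. Qed.

Lemma in_subring_genP (A : comPzRingType) (S : A -> Prop) (x : I -> A) :
  (forall a, S a -> exists t, a = evalT x t) -> (forall i, x i \in in_subring_gen S) ->
  forall a, a \in in_subring_gen S <-> exists t, a = evalT x t.
Proof.
move=> SE xS a; split=> [/asboolP/(_ (fun a => `[< exists t, a = evalT x t >])) H|[t ->]].
  apply/asboolP; apply: H; last by move=> y Sy; apply/asboolP; apply: SE.
  split; first by apply/asboolP; exists ROne.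
  - move=> b c /asboolP[t ->] /asboolP[u ->]; apply/asboolP; by exists (RSub t u).
  - move=> b c /asboolP[t ->] /asboolP[u ->]; apply/asboolP; by exists (RMul t u).
elim: t => [//|||]; first exact: rpred1.
- by move=> t1 h1 t2 h2; apply: rpredB.
- by move=> t1 h1 t2 h2; apply: rpredM.
Qed.

Lemma same_relations (A B : pzRingType) (x : I -> A) (y : I -> B) :
  (forall t, evalT x t = 0 <-> evalT y t = 0) ->
  forall t u, evalT x t = evalT x u <-> evalT y t = evalT y u.
Proof.
move=> xy t u; have := xy (RSub t u); rewrite /= => H.
by split=> E; apply/eqP; rewrite -subr_eq0; apply/eqP/H; rewrite E subrr.
Qed.

(** Two rings generated by families that satisfy the same relations are isomorphic,
    and only one isomorphism matches the generators. *)
Lemma generated_iso (A B : comPzRingType) (SA : A -> Prop) (SB : B -> Prop)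
    (x : I -> A) (y : I -> B) :
  (forall a, a \in in_subring_gen SA <-> exists t, a = evalT x t) ->
  (forall b, b \in in_subring_gen SB <-> exists t, b = evalT y t) ->
  (forall t, evalT x t = 0 <-> evalT y t = 0) ->
  exists! phi : subring_gen SA -> subring_gen SB,
    ring_isomorphism phi /\ forall i z, val z = x i -> val (phi z) = y i.
Proof.
move=> xP yP /same_relations xy.
have tA (a : subring_gen SA) : {t | val a = evalT x t}.
  by apply: cid; apply/xP; apply: valP.
have tB (b : subring_gen SB) : {t | val b = evalT y t}.
  by apply: cid; apply/yP; apply: valP.
have mA t : evalT x t \in in_subring_gen SA by apply/xP; exists t.
have mB t : evalT y t \in in_subring_gen SB by apply/yP; exists t.
pose phi a := SubringGen (mB (sval (tA a))).
pose psi b := SubringGen (mA (sval (tB b))).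
have phiE a t : val a = evalT x t -> val (phi a) = evalT y t.
  by move=> E; apply/xy; rewrite -E; case: (tA a).
have psiE b t : val b = evalT y t -> val (psi b) = evalT x t.
  by move=> E; apply/xy; rewrite -E; case: (tB b).
have isoP : ring_isomorphism phi.
  split.
  - move=> a b; apply/val_inj; have [[t ta] [u ub]] := (tA a, tA b).
    rewrite (phiE _ (RSub t u)); last by rewrite subring_gen_valB ta ub.
    by rewrite subring_gen_valB (phiE _ t) // (phiE _ u).
  - split; first by apply/val_inj; rewrite (phiE _ ROne).
    move=> a b; apply/val_inj; have [[t ta] [u ub]] := (tA a, tA b).
    rewrite (phiE _ (RMul t u)); last by rewrite subring_gen_valM ta ub.
    by rewrite subring_gen_valM (phiE _ t) // (phiE _ u).
  - exists psi => a; apply/val_inj.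
      by have [t ta] := tA a; rewrite (psiE _ t) // (phiE _ t).
    by have [t ta] := tB a; rewrite (phiE _ t) // (psiE _ t).
have phix i z : val z = x i -> val (phi z) = y i by move=> E; apply: (phiE z (RVar i)).
exists phi; split=> // phi' [[phiB phiM _] phi'x]; apply/funext => a.
apply/val_inj; have [t ta] := tA a; rewrite (phiE _ t) //.
have mx i : x i \in in_subring_gen SA by apply: (mA (RVar i)).
have -> : a = evalT (fun i => SubringGen (mx i)) t.
  by apply/val_inj; rewrite ta evalT_val; exact: eq_evalT.
rewrite (evalT_morph _ _ phiB phiM) evalT_val.
by apply: eq_evalT => i /=; apply/esym; apply: phi'x.
Qed.
End Terms.

(** * Polynomials that vanish at all positive integers *)

Section Vanishing.

Lemma digits_injective (B k : nat) (f g : 'I_k -> nat) :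
  (forall i, f i < B)%N -> (forall i, g i < B)%N ->
  (\sum_(i < k) f i * B ^ i = \sum_(i < k) g i * B ^ i)%N -> f =1 g.
Proof.
elim: k f g => [|k IH] f g fB gB; first by move=> _ [].
rewrite !big_ord_recl /= !muln1.
have shift (h : 'I_k.+1 -> nat) : (\sum_(i < k) h (lift ord0 i) * B ^ (bump 0 i) =
    (\sum_(i < k) h (lift ord0 i) * B ^ i) * B)%N.
  by rewrite big_distrl /=; apply: eq_bigr => i _; rewrite /bump add1n expnS; lia.
rewrite !shift => E.
have B0 : (0 < B)%N by apply: leq_ltn_trans (fB ord0).
have E0 : f ord0 = g ord0.
  have /(congr1 (modn^~ B)) := E.
  by rewrite ![(_ + _ * B)%N]addnC !modnMDl !modn_small.
move: E; rewrite E0 => /addnI/eqP; rewrite eqn_pmul2r // => /eqP E i.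
have EL := IH (f \o lift ord0) (g \o lift ord0) (fun i => fB _) (fun i => gB _) E.
by case: (unliftP ord0 i) => [j|] ->; [exact: EL|].
Qed.

(** Kronecker substitution: replacing the i-th variable by the power of x with exponent
    B ^ i, for B beyond all exponents, sends distinct monomials to distinct powers of
    x, and a polynomial in x with infinitely many roots is zero. *)
Lemma mpoly_vanish (R : idomainType) (k : nat) (P : {mpoly R[k]}) :
  injective (fun n : nat => n%:R : R) ->
  (forall e : 'I_k -> nat, (forall i, 0 < e i)%N -> P.@[fun i => (e i)%:R] = 0) ->
  P = 0.
Proof.
move=> natI P0; apply/eqP; apply: contraT => nP.
pose B := msize P; pose w (m : 'X_{1..k}) := (\sum_(i < k) m i * B ^ i)%N.
have wI : {in msupp P &, injective w}.
  have lt_B m : m \in msupp P -> forall i, (m i < B)%N.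
    move=> mP i; apply: leq_ltn_trans (msize_mdeg_lt mP).
    by rewrite mdegE (bigD1 i) //= leq_addr.
  by move=> m m' mP mP' /(digits_injective (lt_B _ mP) (lt_B _ mP')) E; apply/mnmP.
pose q : {poly R} := \sum_(m <- msupp P) P@_m *: 'X^(w m).
have qE (x : nat) : (0 < x)%N -> q.[x%:R] = 0.
  move=> x0; rewrite -[RHS](P0 (fun i => x ^ (B ^ i))%N); last by move=> i; rewrite expn_gt0 x0.
  rewrite mevalE /q horner_sum; apply: eq_bigr => m _.
  rewrite hornerZ hornerXn; congr (_ * _).
  rewrite /w expr_sum; apply: eq_bigr => i _.
  by rewrite natrX -exprM mulnC.
have q0 : q = 0.
  apply/eqP; apply: contraT => nq.
  have := max_poly_roots (rs := [seq i.+1%:R | i <- iota 0 (size q)]) nq.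
  rewrite size_map size_iota ltnn => -> //.
    by apply/allP => _ /mapP[i _ ->]; apply/rootP/qE.
  by rewrite map_inj_uniq ?iota_uniq // => i j /natI[].
have := mlead_supp nP; set m := mlead P => mP.
have : q`_(w m) = P@_m.
  rewrite /q coef_sum (big_rem m) //= coefZ coefXn eqxx mulr1 big_seq big1 ?addr0 // => m'.
  rewrite mem_rem_uniq ?msupp_uniq // => /andP[/= ne m'P].
  by rewrite coefZ coefXn (inj_in_eq wI) // eq_sym (negPf ne) mulr0.
by rewrite q0 coef0 => /esym/eqP; rewrite mcoeff_eq0 mP.
Qed.

End Vanishing.

(** * Fields of fractions *)

Section Fractions.

Lemma fraction_quotient (D : idomainType) (x : {fraction D}) :
  exists n d, d != 0 /\ x * tofrac d = tofrac n.
Proof.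
elim/quotW: x => r; exists \n_r, \d_r; split; first exact: denom_ratioP.
unlock FracField.tofrac; rewrite -[LHS]FracField.pi_mul; apply/eqmodP.
rewrite /= FracField.equivfE /FracField.mulf !numden_Ratio ?oner_neq0 ?mulr1 ?denom_ratioP //.
by rewrite mulrC.
Qed.


Lemma fraction_lift (D : idomainType) (K : fieldType) (g : {rmorphism D -> K}) :
  injective g ->
  exists G : {rmorphism {fraction D} -> K}, forall x, G (tofrac x) = g x.
Proof.
move=> gI; have g0 x : x != 0 -> g x != 0 by move=> nx; rewrite -(rmorph0 g) (inj_eq gI).
have fr (x : {fraction D}) : {nd : D * D | nd.2 != 0 /\ x * tofrac nd.2 = tofrac nd.1}.
  by apply: cid; have [n [d H]] := fraction_quotient x; exists (n, d).
pose G x := g (sval (fr x)).1 / g (sval (fr x)).2.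
have GE x n d : d != 0 -> x * tofrac d = tofrac n -> G x = g n / g d.
  move=> nd E; rewrite /G; case: (fr x) => -[n' d'] /= [nd' E'].
  apply/eqP; rewrite eqr_div ?g0 // -!rmorphM (inj_eq gI) -tofrac_eq !tofracM -E -E'.
  by apply/eqP; ring.
have Gtofrac x : G (tofrac x) = g x.
  by rewrite (GE _ x 1) ?oner_neq0 ?rmorph1 ?mulr1 ?invr1 ?mulr1.
have GB : zmod_morphism G.
  move=> x y; have [n [d [nd E]]] := fraction_quotient x.
  have [n' [d' [nd' E']]] := fraction_quotient y.
  rewrite (GE _ _ _ nd E) (GE _ _ _ nd' E') (GE _ (n * d' - n' * d) (d * d')).
  - rewrite rmorphB !rmorphM; field; by rewrite !g0.
  - by rewrite mulf_neq0.
  - by rewrite tofracB !tofracM -E -E'; ring.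
have GM : monoid_morphism G.
  split; first by rewrite -[1]/(tofrac 1) Gtofrac rmorph1.
  move=> x y; have [n [d [nd E]]] := fraction_quotient x.
  have [n' [d' [nd' E']]] := fraction_quotient y.
  rewrite (GE _ _ _ nd E) (GE _ _ _ nd' E') (GE _ (n * n') (d * d')).
  - rewrite !rmorphM; field; by rewrite !g0.
  - by rewrite mulf_neq0.
  - by rewrite !tofracM -E -E'; ring.
pose mB := GRing.isZmodMorphism.Build _ _ G GB.
pose mM := GRing.isMonoidMorphism.Build _ _ G GM.
pose G' : {rmorphism {fraction D} -> K} := HB.pack G mB mM.
by exists G'.
Qed.

Lemma tofrac_inj (D : idomainType) : injective (@tofrac D).
Proof. by move=> x y /eqP; rewrite tofrac_eq => /eqP. Qed.

Lemma common_denominator (D : idomainType) k (P : {mpoly {fraction D}[k]}) :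
  exists (d : D) (Q : {mpoly D[k]}), d != 0 /\
    tofrac d *: P = map_mpoly (@tofrac D) Q.
Proof.
elim/mpolyind: P => [|c m P _ _ [d [Q [nd E]]]].
  by exists 1, 0; rewrite oner_neq0 scaler0 raddf0.
have [n' [d' [nd' E']]] := fraction_quotient c.
exists (d * d'), ((n' * d) *: 'X_[m] + d' *: Q); split; first by rewrite mulf_neq0.
rewrite scalerDr raddfD /= !map_mpolyZ map_mpolyX -E /= !scalerA !tofracM -E'.
by congr (_ *: _ + _ *: _); ring.
Qed.

End Fractions.

(** * Algebraic independence of the edges of a triangulation *)

Lemma eq_mpoly_morph (R : comNzRingType) (S : nzRingType) k
    (f g : {rmorphism {mpoly R[k]} -> S}) :
  (forall c, f c%:MP = g c%:MP) -> (forall i, f 'X_i = g 'X_i) -> f =1 g.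
Proof.
move=> fgC fgX; elim/mpolyind => [|c m P _ _ E]; first by rewrite !rmorph0.
rewrite !rmorphD /= E -mul_mpolyC !rmorphM /= fgC mpolyXE_id !rmorph_prod /=.
by congr (_ * _ + _); apply: eq_bigr => i _; rewrite !rmorphXn /= fgX.
Qed.

Section Transport.
Variable n : nat.
Notation V := 'I_n.+3.
Implicit Types (T : {set {set V}}).

(** The values of t live in D, which embeds both in K and in L.  As the family X is
    rational in its values on the edges of T, it has a copy in the field of fractions
    of D, and the copy can be read in K.  Field morphisms are injective, so no
    relation is gained or lost on the way. *)
Lemma transport_coordinates T (D : idomainType) (K L : fieldType)
    (e0 : {rmorphism D -> K}) (f0 : {rmorphism D -> L}) (X : {set V} -> L)
    (t : {set V} -> D) :
  triangulation T -> injective e0 -> injective f0 ->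
  plucker_rel X -> (forall a b : V, a != b -> X [set a; b] != 0) ->
  (forall e, (forall a b : V, a != b -> e != [set a; b]) -> X e = 0) ->
  (forall e, edge T e -> f0 (t e) = X e) ->
  exists y : {set V} -> K, (forall e, edge T e -> y e = e0 (t e)) /\
    (forall u, evalT y u = 0 <-> evalT X u = 0).
Proof.
move=> tT eI fI plk nz X0 tX.
have [E EE] := fraction_lift eI; have [F FE] := fraction_lift fI.
have XF e : {h | F h = X e}.
  apply: cid; have [/existsP[a /existsP[b /andP[ab /eqP->]]]|H] :=
      boolP [exists a : V, exists b : V, (a != b) && (e == [set a; b])]; last first.
    exists 0; rewrite rmorph0 X0 // => a b ab; apply: contra H => eab.
    by apply/existsP; exists a; apply/existsP; exists b; rewrite ab.
  apply: (edges_generate (S := fun x => exists h, F h = x)) ab => //.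
  - by move=> _ _ [h <-] [h' <-]; exists (h + h'); rewrite rmorphD.
  - by move=> _ _ [h <-] [h' <-]; exists (h * h'); rewrite rmorphM.
  - by move=> _ _ [h <-] [h' <-]; exists (h / h'); rewrite fmorph_div.
  - exact: tT.
  - by move=> e' eT; exists (tofrac (t e')); rewrite FE tX.
pose r e := sval (XF e); have Fr e : F (r e) = X e by rewrite /r; case: (XF e).
exists (E \o r); split=> [e eT|u].
  rewrite /= -EE; congr (E _); apply: (fmorph_inj F).
  by rewrite Fr FE tX.
have -> : evalT X u = F (evalT r u).
  by rewrite evalT_rmorph; apply: eq_evalT => e; rewrite /= Fr.
by rewrite -evalT_rmorph; split=> /eqP; rewrite fmorph_eq0 => /eqP->; rewrite rmorph0.
Qed.
End Transport.

Lemma natr_int_inj : injective (fun k : nat => k%:R : int).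
Proof. by move=> x y /eqP; rewrite eqr_nat => /eqP. Qed.

(** Elements that can be specialized to all positive integers are algebraically
    independent: a relation between them would vanish at all such points.  The variables
    come in two groups because the coefficient field is formed first. *)
Lemma generic_embedding (NJ NI : nat) (Z : idomainType)
    (DJ : 'I_NJ -> Z) (DI : 'I_NI -> Z) :
  (forall (eJ : 'I_NJ -> nat) (eI : 'I_NI -> nat),
     (forall j, 0 < eJ j)%N -> (forall i, 0 < eI i)%N ->
     exists h : {rmorphism Z -> rat},
       (forall j, h (DJ j) = (eJ j)%:R) /\ (forall i, h (DI i) = (eI i)%:R)) ->
  exists f : {rmorphism {mpoly {fraction {mpoly int[NJ]}}[NI]} -> {fraction Z}},
    [/\ injective f, (forall j, f (tofrac 'X_j)%:MP = tofrac (DJ j)) &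
      (forall i, f 'X_i = tofrac (DI i))].
Proof.
move=> real.
pose g0 : {rmorphism {mpoly int[NJ]} -> Z} := mmap (intmul 1 : {rmorphism int -> Z}) DJ.
pose g1 : {rmorphism {mpoly {mpoly int[NJ]}[NI]} -> Z} := mmap g0 DI.
have g0X j : g0 'X_j = DJ j by rewrite /g0 /= mmapX mmap1U.
have g0C c : g0 c%:MP = c%:~R by rewrite /g0 /= mmapC.
have g1X i : g1 'X_i = DI i by rewrite /g1 /= mmapX mmap1U.
have g1C c : g1 c%:MP = g0 c by rewrite /g1 /= mmapC.
have g1_eq0 Q : g1 Q = 0 -> Q = 0.
  move=> Q0; apply/mpolyP => m; rewrite mcoeff0.
  apply: (mpoly_vanish natr_int_inj) => eJ eJpos.
  pose rho : {rmorphism {mpoly int[NJ]} -> int} := meval (fun j => (eJ j)%:R : int).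
  suff QJ : map_mpoly rho Q = 0 by rewrite -[LHS]/(rho Q@_m) -mcoeff_map_mpoly QJ mcoeff0.
  apply: (mpoly_vanish natr_int_inj) => eI eIpos.
  pose tau : {rmorphism {mpoly int[NI]} -> int} := meval (fun i => (eI i)%:R : int).
  have [h [hJ hI]] := real eJ eI eJpos eIpos.
  have h0 P : h (g0 P) = (rho P)%:~R.
    apply: (@eq_mpoly_morph _ _ _ (h \o g0) ((intmul 1 : {rmorphism int -> rat}) \o rho)).
      by move=> c; rewrite /= g0C rmorph_int mevalC.
    by move=> i; rewrite /= g0X hJ mevalXU natz.
  have : h (g1 Q) = (tau (map_mpoly rho Q))%:~R.
    apply: (@eq_mpoly_morph _ _ _ (h \o g1)
      ((intmul 1 : {rmorphism int -> rat}) \o (tau \o map_mpoly rho))).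
      by move=> c; rewrite /= g1C h0 map_mpolyC mevalC.
    by move=> i; rewrite /= g1X hI map_mpolyX mevalXU natz.
  by rewrite Q0 rmorph0 => /esym/eqP; rewrite intr_eq0 => /eqP.
have g0I : injective (@tofrac Z \o g0).
  move=> P Q /= /tofrac_inj E; have {}E : g0 P = g0 Q := E; apply/eqP; rewrite -subr_eq0.
  by rewrite -(mpolyC_eq0 NI) (g1_eq0 (P - Q)%:MP) // g1C rmorphB E subrr.
have [G GE] := fraction_lift g0I.
pose f : {rmorphism {mpoly {fraction {mpoly int[NJ]}}[NI]} -> {fraction Z}} :=
  mmap G (@tofrac Z \o DI).
have fX i : f 'X_i = tofrac (DI i) by rewrite /f /= mmapX mmap1U.
have fC c : f c%:MP = G c by rewrite /f /= mmapC.
have fg1 Q : f (map_mpoly (@tofrac _) Q) = tofrac (g1 Q).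
  apply: (@eq_mpoly_morph _ _ _ (f \o map_mpoly (@tofrac _)) ((@tofrac _) \o g1)).
    by move=> c; rewrite /= map_mpolyC fC GE /= g1C.
  by move=> i; rewrite /= map_mpolyX fX g1X.
exists f; split=> [|j|//]; last by rewrite fC GE /= g0X.
apply: raddf_inj => P P0; have [d [Q [nd E]]] := common_denominator P.
have /eqP : tofrac (g1 Q) = 0 by rewrite -fg1 -E -mul_mpolyC rmorphM /= P0 mulr0.
rewrite tofrac_eq0 => /eqP/g1_eq0 Q0; move/eqP: E; rewrite Q0 raddf0.
rewrite -mul_mpolyC mulf_eq0 mpolyC_eq0 tofrac_eq0 (negPf nd) /=.
by move/eqP.
Qed.

(** * Relations with scalars extended from the integers *)

Section TensorRelation.
Variables (C : numFieldType) (RZ M : zmodType) (N : nat).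
Variables (pol : {additive RZ -> {mpoly int[N]}}) (beta : C -> RZ -> M).
Hypothesis pol_inj : injective pol.
Hypothesis betaB1 : forall r, zmod_morphism (beta^~ r).
Hypothesis betaB2 : forall c, zmod_morphism (beta c).

Let beta1 r : {additive C -> M} :=
  HB.pack (beta^~ r) (GRing.isZmodMorphism.Build _ _ (beta^~ r) (betaB1 r)).
Let beta2 c : {additive RZ -> M} :=
  HB.pack (beta c) (GRing.isZmodMorphism.Build _ _ (beta c) (betaB2 c)).

Lemma beta_suml r I (F : I -> C) (s : seq I) :
  beta (\sum_(i <- s) F i) r = \sum_(i <- s) beta (F i) r.
Proof. exact: (raddf_sum (beta1 r)). Qed.
Lemma beta_sumr c I (F : I -> RZ) (s : seq I) :
  beta c (\sum_(i <- s) F i) = \sum_(i <- s) beta c (F i).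
Proof. exact: (raddf_sum (beta2 c)). Qed.
Lemma beta_Mz c r z : beta (c *~ z) r = beta c (r *~ z).
Proof. by rewrite [RHS](raddfMz (beta2 c)) [LHS](raddfMz (beta1 r)). Qed.
Lemma beta0l r : beta 0 r = 0. Proof. exact: (raddf0 (beta1 r)). Qed.
Lemma beta0r c : beta c 0 = 0. Proof. exact: (raddf0 (beta2 c)). Qed.

(** A relation over C between integral polynomials is a consequence of relations over
    the integers.  In a basis adapted to the Smith normal form of the matrix of
    coefficients, each new scalar or the corresponding new polynomial is zero. *)
Lemma tensor_relation k (c : 'I_k -> C) (r : 'I_k -> RZ) :
  \sum_i c i *: map_mpoly (intmul 1 : {rmorphism int -> C}) (pol (r i)) = 0 ->
  \sum_i beta (c i) (r i) = 0.
Proof.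
move=> rel.
pose ms := flatten [seq msupp (pol (r i)) | i <- enum 'I_k].
pose K := size ms.
pose A := \matrix_(i < k, j < K) (pol (r i))@_(nth 0%MM ms j).
have [L Lu [R Ru [d _ AE]]] := int_Smith_normal_form A.
set D := (X in L *m X *m R) in AE.
pose cv : 'rV[C]_k := \row_i c i.
pose toC p q (B : 'M[int]_(p, q)) : 'M[C]_(p, q) := map_mx (intmul 1 : {rmorphism int -> C}) B.
have cA : cv *m toC _ _ A = 0.
  apply/rowP => j; rewrite !mxE.
  have := congr1 (mcoeff (nth 0%MM ms j)) rel.
  rewrite mcoeff0 raddf_sum /= => {2}<-; apply: eq_bigr => i _.
  by rewrite !mxE mcoeffZ mcoeff_map_mpoly.
have c'D : (cv *m toC _ _ L) *m toC _ _ D = 0.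
  have RV : toC _ _ R *m toC _ _ (invmx R) = 1%:M by rewrite /toC -map_mxM mulmxV // map_mx1.
  by move: cA; rewrite AE /toC !map_mxM !mulmxA => H; rewrite -[LHS]mulmx1 -RV mulmxA H mul0mx.
set c' := cv *m toC _ _ L in c'D.
(* The families c' and r' are c and r in the basis adapted to the normal form: D is
   diagonal and c' *m D = 0, so c' j = 0 or row j of D vanishes, and then r' j = 0. *)
pose r' (j : 'I_k) : RZ := \sum_i r i *~ (invmx L) j i.
have rE i : r i = \sum_j r' j *~ L i j.
  transitivity (\sum_l r l *~ (L *m invmx L) i l).
    rewrite mulmxV // (bigD1 i) //= mxE eqxx big1 ?addr0 // => l /negPf nl.
    by rewrite mxE eq_sym nl.
  under eq_bigr do rewrite mxE mulrz_sumr.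
  rewrite exchange_big; apply: eq_bigr => j _ /=.
  by rewrite /r' mulrz_suml; apply: eq_bigr => l _; rewrite -mulrzA mulrC.
have -> : \sum_i beta (c i) (r i) = \sum_j beta (c' 0 j) (r' j).
  transitivity (\sum_i \sum_j beta (c i *~ L i j) (r' j)).
    apply: eq_bigr => i _; rewrite rE beta_sumr; apply: eq_bigr => j _.
    by rewrite beta_Mz.
  rewrite exchange_big; apply: eq_bigr => j _ /=.
  rewrite -beta_suml !mxE; congr (beta _ _).
  by apply: eq_bigr => i _; rewrite !mxE mulrzr.
have coef_r' j m : (pol (r' j))@_m = \sum_i (invmx L) j i * (pol (r i))@_m.
  rewrite /r' !raddf_sum /=; apply: eq_bigr => i _.
  by rewrite !raddfMz /= -mulrzr mulrC intz.
have DR : invmx L *m A = D *m R by rewrite AE !mulmxA mulVmx // mul1mx.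
apply: big1 => j _; have [c0|c0] := eqVneq (c' 0 j) 0.
  by rewrite c0 beta0l.
have D0 l : D j l = 0.
  rewrite mxE; have [jl|//] := eqVneq (j : nat) l; rewrite mulr1n.
  have toCD i : toC _ _ D i l = (d`_i *+ (i == l :> nat))%:~R by rewrite !mxE.
  move/rowP/(_ l): c'D; rewrite mxE (bigD1 j) //= big1 ?addr0 => [|i ij]; last first.
    by rewrite toCD -jl; have /negPf -> : (i : nat) != j by []; rewrite mulr0n mulr0.
  by rewrite toCD jl eqxx mulr1n [X in _ = X -> _]mxE => /eqP; rewrite mulf_eq0 (negPf c0) intr_eq0 => /eqP.
have r0 : r' j = 0.
  apply: pol_inj; rewrite raddf0; apply/mpolyP => m; rewrite mcoeff0 coef_r'.
  have [/(nthP 0%MM)[l lt_l <-]|nm] := boolP (m \in ms).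
    have := congr1 (fun B : 'M_(_, _) => B j (Ordinal lt_l)) DR; rewrite !mxE.
    rewrite [RHS]big1 => [E|l' _]; last by rewrite D0 mul0r.
    by rewrite -[RHS]E; apply: eq_bigr => i _; rewrite mxE.
  apply: big1 => i _; rewrite memN_msupp_eq0 ?mulr0 //.
  apply: contra nm => mi; apply/flattenP; exists (msupp (pol (r i))) => //.
  by apply: map_f; rewrite mem_enum.
by rewrite r0 beta0r.
Qed.
End TensorRelation.

(** * The coordinate ring of the cone *)

Section Coordinates.
Variables (C : numFieldType) (n : nat).
Notation V := 'I_n.+3.
Notation Z := {mpoly int[n.+3 + n.+3]}.

(** The two rows of the generic matrix. *)
Definition gen_u (a : V) : Z := 'X_(lshift n.+3 a).
Definition gen_v (a : V) : Z := 'X_(rshift n.+3 a).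
Notation gminor := (minor gen_u gen_v).

Lemma minor_morph (A B : pzRingType) (f : {rmorphism A -> B}) (u v : V -> A) e :
  f (minor u v e) = minor (f \o u) (f \o v) e.
Proof.
rewrite /minor raddf_sum; apply: eq_bigr => p _.
by rewrite /= rmorphB !rmorphM.
Qed.

Lemma eq_minor (A : pzRingType) (u u' v v' : V -> A) : u =1 u' -> v =1 v' ->
  minor u v =1 minor u' v'.
Proof. by move=> uu vv e; apply: eq_bigr => p _; rewrite !uu !vv. Qed.

Definition join_uv (A : Type) (u v : V -> A) (i : 'I_(n.+3 + n.+3)) : A :=
  match fintype.split i with inl a => u a | inr a => v a end.

Lemma generic_specialization (A : comNzRingType) (u v : V -> A) :
  exists h : {rmorphism Z -> A}, forall e, h (gminor e) = minor u v e.
Proof.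
pose h : {rmorphism Z -> A} := mmap (intmul 1 : {rmorphism int -> A}) (join_uv u v).
exists h => e; rewrite minor_morph; apply: eq_minor => a.
  by rewrite /= /gen_u mmapX mmap1U /join_uv -[lshift _ _]/(unsplit (inl _ a)) unsplitK.
by rewrite /= /gen_v mmapX mmap1U /join_uv -[rshift _ _]/(unsplit (inr _ a)) unsplitK.
Qed.

Lemma eval_gminor (u v : V -> C) t :
  (map_mpoly (intmul 1 : {rmorphism int -> C}) (evalT gminor t)).@[join_uv u v] =
  evalT (minor u v) t.
Proof.
pose h : {rmorphism Z -> C} :=
  meval (join_uv u v) \o map_mpoly (intmul 1 : {rmorphism int -> C}).
rewrite -[LHS]/(h _) evalT_rmorph; apply: eq_evalT => e.
rewrite [LHS]minor_morph; apply: eq_minor => a.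
  by rewrite /= /gen_u map_mpolyX mevalXU /join_uv -[lshift _ _]/(unsplit (inl _ a)) unsplitK.
by rewrite /= /gen_v map_mpolyX mevalXU /join_uv -[rshift _ _]/(unsplit (inr _ a)) unsplitK.
Qed.

Lemma gminor_neq0 (a b : V) : a != b -> gminor [set a; b] != 0.
Proof.
move: a b; apply: (@set2_wlog _ (fun e => gminor e != 0)) => a b ab.
have [h hE] := generic_specialization (fun x : V => (x == a)%:Z) (fun x : V => (x == b)%:Z).
apply/eqP => /(congr1 h); rewrite hE rmorph0 minorE //.
by rewrite !eqxx [b == a]eq_sym eq_ord (ltn_eqF ab).
Qed.

Lemma minor_nonedge (A : pzRingType) (u v : V -> A) (e : {set V}) :
  (forall a b : V, a != b -> e != [set a; b]) -> minor u v e = 0.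
Proof. by move=> H; apply: minor_out => a b ab; apply: H; rewrite eq_ord (ltn_eqF ab). Qed.

(** Coordinates labelled by sets, like [minor]: sets that are not pairs get 0. *)
Definition plucker_edge (e : {set V}) : coord_ring C n :=
  if [pick p : V * V | (p.1 < p.2)%N && (e == [set p.1; p.2])] is Some p
  then plucker C p.1 p.2 else 0.

Lemma plucker_edgeE (a b : V) : (a < b)%N -> plucker_edge [set a; b] = plucker C a b.
Proof.
move=> ab; rewrite /plucker_edge; case: pickP => [[x y] /=|/(_ (a, b))].
  rewrite set2_eq => /andP[xy /orP[]/andP[/eqP aE /eqP bE]]; subst => //.
  by move: ab; rewrite ltnNge ltnW.
by rewrite ab eqxx.
Qed.

Lemma coord_ring_ext (f g : coord_ring C n) : (forall w, val f w = val g w) -> f = g.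
Proof. by move=> fg; apply/val_inj/funext. Qed.

Lemma plucker_edge_eval (w : cone C n) (u v : 'rV[C]_n.+3) e :
  sval w = \matrix_(a, b) (u 0 a * v 0 b - u 0 b * v 0 a) ->
  val (plucker_edge e) w = minor (u 0) (v 0) e.
Proof.
move=> wE; rewrite /plucker_edge; case: pickP => [[a b] /= /andP[ab /eqP->]|H].
  by rewrite /plucker_fun wE mxE minorE.
by rewrite minor_out // => a b ab; apply: contraFneq (H (a, b)) => -> /=; rewrite ab eqxx.
Qed.

Lemma evalT_coord (w : cone C n) (u v : 'rV[C]_n.+3) t :
  sval w = \matrix_(a, b) (u 0 a * v 0 b - u 0 b * v 0 a) ->
  val (evalT plucker_edge t) w = evalT (minor (u 0) (v 0)) t.
Proof.
move=> wE; rewrite evalT_val.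
rewrite (@evalT_morph _ _ _ (fun f : cone C n -> C => f w)) //.
by apply: eq_evalT => e; exact: plucker_edge_eval.
Qed.

(** The pairs (u, v) with zero bivector, which are not allowed, are removed by
    multiplying with a single minor. *)
Lemma cone_dense (P : {mpoly C[n.+3 + n.+3]}) :
  (forall (w : cone C n) (u v : 'rV[C]_n.+3),
     sval w = \matrix_(a, b) (u 0 a * v 0 b - u 0 b * v 0 a) ->
     P.@[join_uv (u 0) (v 0)] = 0) -> P = 0.
Proof.
move=> H; pose D := map_mpoly (intmul 1 : {rmorphism int -> C}) (gminor [set ord0; ord_max]).
have DE (u v : V -> C) : D.@[join_uv u v] = minor u v [set ord0; ord_max].
  exact: (eval_gminor u v (RVar _)).
have D0 : D != 0.
  apply/eqP => D0; have := DE (fun a => (a == ord0)%:R) (fun a => (a == ord_max)%:R).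
  rewrite D0 meval0 minorE // !eqxx (_ : (ord_max == ord0 :> V) = false) //.
  by move/eqP; rewrite mulr1 mul0r subr0 eq_sym oner_eq0.
have natI : injective (fun k : nat => k%:R : C) by move=> x y /eqP; rewrite eqr_nat => /eqP.
suff /eqP : P * D = 0 by rewrite mulf_eq0 (negPf D0) orbF => /eqP.
apply: (mpoly_vanish natI) => e _.
pose u : 'rV[C]_n.+3 := \row_a (e (lshift _ a))%:R.
pose v : 'rV[C]_n.+3 := \row_a (e (rshift _ a))%:R.
have eE : (fun i => (e i)%:R : C) =1 join_uv (u 0) (v 0).
  by move=> i; rewrite /join_uv; case: (splitP i) => a ia; rewrite mxE;
     congr (_%:R); congr (e _); apply/val_inj.
rewrite (meval_eq _ eE) mevalM DE.
pose w := \matrix_(a, b) (u 0 a * v 0 b - u 0 b * v 0 a).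
have [w0|nw] := eqVneq w 0.
  suff -> : minor (u 0) (v 0) [set ord0; ord_max] = 0 by rewrite mulr0.
  by rewrite minorE //; have := congr1 (fun A : 'M_(_, _) => A ord0 ord_max) w0; rewrite !mxE.
have Pw : w != 0 /\ exists u v : 'rV[C]_n.+3, w = \matrix_(a, b) (u 0 a * v 0 b - u 0 b * v 0 a).
  by split=> //; exists u, v.
by rewrite (H (exist _ w Pw) u v) // mul0r.
Qed.

(** Relations between Pluecker coordinates on the cone are polynomial identities between
    generic minors over the integers; in particular they hold over every commutative
    ring. *)
Lemma coord_relations t : evalT plucker_edge t = 0 <-> evalT gminor t = 0.
Proof.
split=> [E|E]; last first.
  apply: coord_ring_ext => w; have [_ [u [v wE]]] := svalP w.
  have [h hE] := generic_specialization (u 0) (v 0).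
  rewrite (evalT_coord _ wE) -(eq_evalT (x := h \o gminor)) //.
  by rewrite -evalT_rmorph E rmorph0.
have inC : injective (map_mpoly (n := n.+3 + n.+3) (intmul 1 : {rmorphism int -> C})).
  apply: raddf_inj => P P0; apply/mpolyP => m; apply/eqP.
  by rewrite mcoeff0 -(intr_eq0 C) -[_%:~R]/((intmul 1 : {rmorphism int -> C}) _)
    -mcoeff_map_mpoly P0 mcoeff0.
apply: inC; rewrite raddf0; apply: cone_dense => w u v wE.
by rewrite eval_gminor -(evalT_coord _ wE) E.
Qed.

Lemma Z_coord_ringP (f : coord_ring C n) :
  f \in in_subring_gen (@Z_coord_ring_generator C n) <->
  exists t, f = evalT plucker_edge t.
Proof.
apply: in_subring_genP => [g [a [b [ab ->]]]|e].
  by exists (RVar [set a; b]); rewrite /= plucker_edgeE.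
rewrite /plucker_edge; case: pickP => [[a b] /= /andP[ab _]|_]; last exact: rpred0.
by apply: mem_subring_gen; exists a, b.
Qed.

End Coordinates.

(** * The integral form *)

Section ZForm.
Variables (C : numFieldType) (n : nat).
Notation V := 'I_n.+3.
Notation Z := {mpoly int[n.+3 + n.+3]}.
Notation gminor := (minor (@gen_u n) (@gen_v n)).
Notation RZ := (Z_coord_ring C n).

(** The integral form becomes a ring of polynomials with integer coefficients, to which
    [tensor_relation] applies. *)
Lemma coord_lift : exists pol : {additive RZ -> Z}, injective pol /\
  forall r t, val r = evalT (@plucker_edge C n) t -> pol r = evalT gminor t.
Proof.
have rel := same_relations (@coord_relations C n).
have tm (r : RZ) : {t | val r = evalT (@plucker_edge C n) t}.
  by apply: cid; apply/Z_coord_ringP; apply: valP.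
pose pol r := evalT gminor (sval (tm r)).
have polE r t : val r = evalT (@plucker_edge C n) t -> pol r = evalT gminor t.
  by move=> E; apply/rel; rewrite -E; case: (tm r).
have polB : zmod_morphism pol.
  move=> r s; have [[t rt] [u su]] := (tm r, tm s).
  rewrite (polE _ (RSub t u)); last by rewrite subring_gen_valB rt su.
  by rewrite (polE _ t) // (polE _ u).
have polI : injective pol.
  move=> r s; have [[t rt] [u su]] := (tm r, tm s).
  by rewrite (polE _ t) // (polE _ u) // => /rel E; apply/val_inj; rewrite rt su.
pose pB := GRing.isZmodMorphism.Build _ _ pol polB.
by exists (HB.pack pol pB : {additive RZ -> Z}).
Qed.

Notation comb s := (\sum_(p <- s) coord_const n p.1 * val (p.2 : RZ)).

Lemma combB (s s' : seq (C * RZ)) :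
  comb s - comb s' = comb (s ++ [seq (- p.1, p.2) | p <- s']).
Proof.
rewrite big_cat /= big_map -sumrN; congr (_ + _); apply: eq_bigr => p _ /=.
by rewrite rmorphN mulNr.
Qed.

Lemma combM (s s' : seq (C * RZ)) :
  comb s * comb s' = comb [seq (p.1 * p'.1, p.2 * p'.2) | p <- s, p' <- s'].
Proof.
rewrite big_distrl /= big_allpairs_dep; apply: eq_bigr => p _.
rewrite big_distrr /=; apply: eq_bigr => p' _ /=.
by rewrite mulrACA rmorphM; congr (_ * _).
Qed.

(** The multiplication map from the tensor product is onto; tensors are represented by
    lists of pairs. *)
Lemma comb_exists (f : coord_ring C n) : exists s : seq (C * RZ), f = comb s.
Proof.
pose cv (g : cone C n -> C) := exists s : seq (C * RZ), g = val (comb s).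
suff : cv (val f) by move=> [s E]; exists s; apply/val_inj.
have /asboolP/(_ (fun g => `[< cv g >])) H := valP f.
apply/asboolP; apply: H; first split.
- apply/asboolP; exists [:: (1, 1)]; rewrite big_seq1 /=; apply/funext => w /=.
  by rewrite mulr1.
- move=> _ _ /asboolP[s ->] /asboolP[s' ->]; apply/asboolP.
  by exists (s ++ [seq (- p.1, p.2) | p <- s']); rewrite -combB subring_gen_valB.
- move=> _ _ /asboolP[s ->] /asboolP[s' ->]; apply/asboolP.
  by exists [seq (p.1 * p'.1, p.2 * p'.2) | p <- s, p' <- s']; rewrite -combM subring_gen_valM.
- move=> g [[c ->]|[a [b ->]]]; apply/asboolP.
    exists [:: (c, 1)]; rewrite big_seq1 /=; apply/funext => w /=; by rewrite mulr1.
  have mem (x y : V) : (x < y)%N -> plucker C x y \in in_subring_gen (@Z_coord_ring_generator C n).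
    by move=> xy; apply: mem_subring_gen; exists x, y.
  have [ab|ba|ab] := ltngtP a b.
  + exists [:: (1, SubringGen (mem a b ab))]; rewrite big_seq1 /=; apply/funext => w /=.
    by rewrite mul1r.
  + exists [:: (-1, SubringGen (mem b a ba))]; rewrite big_seq1 /=; apply/funext => w /=.
    rewrite mulN1r -[RHS]/(- sval w b a) /plucker_fun; have [_ [u [v ->]]] := svalP w.
    by rewrite !mxE opprB.
  + exists [::]; rewrite big_nil /=; apply/funext => w /=.
    rewrite /plucker_fun; have [_ [u [v ->]]] := svalP w.
    by rewrite mxE (val_inj ab) subrr.
Qed.

(** The map out of the coordinate ring is defined on combinations of integral elements;
    [tensor_relation] shows that it does not depend on the chosen combination. *)
Theorem coord_Z_form : Z_form (@coord_const C n) RZ.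
Proof.
move=> M beta betaB1 betaB2.
have [pol [polI polE]] := coord_lift.
have rel (s : seq (C * RZ)) : comb s = 0 -> \sum_(p <- s) beta p.1 p.2 = 0.
  rewrite (big_tnth _ _ s) => E; rewrite (big_tnth _ _ s).
  apply: (tensor_relation polI betaB1 betaB2).
  apply: cone_dense => w u v wE; rewrite raddf_sum /=.
  pose ev (f : coord_ring C n) := val f w.
  have evM c f : ev (coord_const n c * f) = c * ev f.
    by rewrite /ev (subring_gen_valM (coord_const n c) f).
  have evB : zmod_morphism ev by move=> f f'; rewrite /ev (subring_gen_valB f f').
  pose eva := HB.pack ev (GRing.isZmodMorphism.Build _ _ ev evB) : {additive _ -> C}.
  transitivity (eva (\sum_(i < size s)
      coord_const n (tnth (in_tuple s) i).1 * val (tnth (in_tuple s) i).2)); last first.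
    by rewrite E.
  rewrite raddf_sum; apply: eq_bigr => i _; rewrite mevalZ.
  rewrite [RHS]evM.
  have /Z_coord_ringP[t tE] := valP (tnth (in_tuple s) i).2.
  by rewrite (polE _ _ tE) eval_gminor -(evalT_coord _ wE) -tE.
pose rep f := sval (cid (comb_exists f)).
have repE f : f = comb (rep f) := svalP (cid (comb_exists f)).
pose g f := \sum_(p <- rep f) beta p.1 p.2.
have betaB s s' : \sum_(p <- s) beta p.1 p.2 - \sum_(p <- s') beta p.1 p.2 =
    \sum_(p <- s ++ [seq (- p.1, p.2) | p <- s']) beta p.1 p.2.
  rewrite big_cat /= big_map -sumrN; congr (_ + _); apply: eq_bigr => p _ /=.
  by rewrite -[- p.1]sub0r betaB1 (beta0l betaB1) sub0r.
have gE s : g (comb s) = \sum_(p <- s) beta p.1 p.2.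
  by apply/eqP; rewrite -subr_eq0 betaB rel // -combB -repE subrr.
have gB : zmod_morphism g.
  by move=> f f'; rewrite {1}(repE f) {1}(repE f') combB gE -betaB.
exists g; split; first split=> // c r.
  by have := gE [:: (c, r)]; rewrite !big_seq1.
move=> g' [g'B g'E]; apply/funext => f; rewrite (repE f) gE.
pose g'a := GRing.isZmodMorphism.Build _ _ g' g'B.
rewrite [RHS](raddf_sum (HB.pack g' g'a : {additive _ -> _})).
by apply: eq_bigr => p _; rewrite -g'E.
Qed.

End ZForm.

(** * Pluecker coordinates in the ambient field *)

Section Ambient.
Variable n : nat.
Notation V := 'I_n.+3.
Notation Z := {mpoly int[n.+3 + n.+3]}.
Notation gminor := (minor (@gen_u n) (@gen_v n)).
Variables (T : {set {set V}}) (tT : triangulation T) (s0 : tri_seed T).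
Hypothesis hs0 : initial_seed s0.

Notation K := (ambient (side n) n).

Let K0 : idomainType := coef_field (side n).

Let e0 : {rmorphism {mpoly K0[#|diag_of T|]} -> K} :=
  mmap (@tofrac {mpoly K0[n]} \o @mpolyC n K0) (fun i => cluster s0 (enum_val i)).

Definition coef_rmorph : {rmorphism K0 -> K} := @tofrac {mpoly K0[n]} \o @mpolyC n K0.

Lemma trop_inj_var j : trop_inj n (trop_var j) = coef_rmorph (tofrac 'X_(enum_rank j)).
Proof.
rewrite /trop_inj -[coef_field_inj _ _]/(coef_rmorph _); congr (coef_rmorph _).
rewrite (bigD1 j) //= ffunE eqxx big1 ?mulr1 // => i /negPf ij.
by rewrite ffunE ij.
Qed.

Lemma trop_inj_prod (p : trop (side n)) :
  trop_inj n p = \prod_j trop_inj n (trop_var j) ^ p j.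
Proof.
rewrite {1}/trop_inj -[coef_field_inj _ _]/(coef_rmorph _) rmorph_prod.
by apply: eq_bigr => j _; rewrite trop_inj_var fmorphXz.
Qed.

Lemma tri_not_side e : e \in T -> is_side e = false.
Proof. by move=> /(triangulation_diag tT) /andP[_ /negPf]. Qed.

(** The coordinates carry the cluster variables and the coefficient generators of the
    initial seed and satisfy the same relations as generic minors.  Both families of
    edge values come from the same polynomial ring, which embeds in the ambient field
    because the initial cluster is a transcendence basis, and in the field of
    rational functions of a generic matrix by [positive_realization]. *)
Lemma cluster_coordinates : exists y : {set V} -> K,
  [/\ (forall j : side n, y (val j) = trop_inj n (trop_var j)),
      (forall i : diag_of T, y (val i) = cluster s0 i) &
      forall t, evalT y t = 0 <-> evalT gminor t = 0].
Proof.
pose DJ (j : 'I_#|side n|) := gminor (val (enum_val j)).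
pose DI (i : 'I_#|diag_of T|) := gminor (val (enum_val i)).
have [f [fI fJ fX]] : exists f : {rmorphism {mpoly K0[#|diag_of T|]} -> {fraction Z}},
    [/\ injective f, (forall j, f (tofrac 'X_j)%:MP = tofrac (DJ j)) &
      (forall i, f 'X_i = tofrac (DI i))].
  apply: generic_embedding => eJ eI eJpos eIpos.
  pose c (e : {set V}) : rat := if insub e : option (side n) is Some j then (eJ (enum_rank j))%:R
    else if insub e : option (diag_of T) is Some i then (eI (enum_rank i))%:R else 1.
  have cpos e : edge T e -> 0 < c e.
    by move=> _; rewrite /c; case: insubP => [j _ _|_]; [|case: insubP => [i _ _|_]]; rewrite ?ltr0n.
  have [u [v [_ uv]]] := positive_realization tT cpos; have [h hE] := generic_specialization u v.
  exists h; split=> k.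
    have jE := valP (enum_val k : side n).
    by rewrite hE uv /edge ?jE // /c valK enum_valK.
  have iE := valP (enum_val k : diag_of T).
  by rewrite hE uv /edge ?iE ?orbT // /c insubF ?tri_not_side // valK enum_valK.
pose X e : {fraction Z} := tofrac (gminor e).
pose t (e : {set V}) : {mpoly K0[#|diag_of T|]} :=
  if insub e : option (side n) is Some j then (tofrac 'X_(enum_rank j))%:MP
    else if insub e : option (diag_of T) is Some i then 'X_(enum_rank i) else 0.
have tJ (j : side n) : t (val j) = (tofrac 'X_(enum_rank j))%:MP by rewrite /t valK.
have tI (i : diag_of T) : t (val i) = 'X_(enum_rank i).
  by rewrite /t insubF ?valK // tri_not_side // (valP i).
have [||||||y [yE yrel]] := @transport_coordinates n T _ _ _ e0 f X t tT.
- by apply: raddf_inj => P; case: (initial_cluster hs0) => H _; exact: H.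
- exact: fI.
- by move=> a b c d Q; rewrite /X -!rmorphM -rmorphD minor_plucker.
- by move=> a b ab; rewrite /X tofrac_eq0 gminor_neq0.
- by move=> e H; rewrite /X minor_nonedge // rmorph0.
- move=> e /orP[s|eT].
    by rewrite -[e]/(val (Sub e s : side n)) tJ fJ /DJ enum_rankK.
  by rewrite -[e]/(val (Sub e eT : diag_of T)) tI fX /DI enum_rankK.
exists y; split=> [j|i|u].
- rewrite yE ?/edge ?(valP j) // tJ trop_inj_var.
  by rewrite -[LHS]/(mmap _ _ _) mmapC.
- rewrite yE ?/edge ?(valP i) ?orbT // tI.
  by rewrite -[LHS]/(mmap _ _ _) mmapX mmap1U enum_rankK.
- rewrite yrel -(evalT_rmorph (@tofrac Z)); split=> [/eqP|->]; last by rewrite rmorph0.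
  by rewrite tofrac_eq0 => /eqP.
Qed.

End Ambient.

(** * Seeds of labelled triangulations *)

Section Seeds.
Variable n : nat.
Notation V := 'I_n.+3.
Notation ed T a b := (edge T [set a; b]).
Notation K := (ambient (side n) n).
Variables (T : {set {set V}}) (s0 : tri_seed T).
Notation I := (diag_of T).
Notation J := (side n).

Variable y : {set V} -> K.
Hypothesis yJ : forall j : J, y (val j) = trop_inj n (trop_var j).
Hypothesis plk : plucker_rel y.
Hypothesis nz : forall a b : V, a != b -> y [set a; b] != 0.

Notation im d := [set d i | i : I].

(** The invariant preserved by mutations.  The coefficients are the positive and negative
    parts of the rows of [tri_matrix] indexed by the sides. *)
Record geometric_seed (d : I -> {set V}) (s : tri_seed T) : Prop := {
  geo_triangulation : triangulation (im d);
  geo_injective : injective d;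
  geo_cluster : forall i, cluster s i = y (d i);
  geo_pos : forall i e, coef_pos s i e = Num.max (tri_matrix (im d) (val e) (d i)) 0;
  geo_neg : forall i e, coef_neg s i e = Num.max (- tri_matrix (im d) (val e) (d i)) 0;
  geo_exch : forall i j, exch s i j = tri_matrix (im d) (d i) (d j)
}.

Lemma image_val : im val = T.
Proof.
apply/setP => e; apply/imsetP/idP => [[i _ ->]|eT]; first exact: (valP i).
by exists (Sub e eT : I).
Qed.

Lemma q_val a b (e : J) : q a b e = (val e == [set a; b])%:Z.
Proof.
rewrite /q; case: insubP => [j _ jE|ns]; first by rewrite ffunE -jE.
rewrite ffunE; case: eqP => // eE; case/negP: ns; rewrite -eE; exact: (valP e).
Qed.

Lemma tri_triangle_of (U : {set {set V}}) (a b c : V) : tri U a b c -> triangle_of U a b c.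
Proof.
case/and4P=> /ccw_neq[ab bc ac] h1 h2 h3.
by rewrite /triangle_of /= !inE negb_or ab bc ac /= -!/(edge _ _) h1 h2 edC h3.
Qed.

Lemma triangle_of_tri (U : {set {set V}}) (a b c : V) : triangle_of U a b c ->
  if ccw a b c then tri U a b c else tri U a c b.
Proof.
case/and4P; rewrite /= !inE negb_or => /and3P[/andP[ab ac] bc _] h1 h2 h3.
have := ccw_total ab bc ac; rewrite /tri ![ed U b a]edC ![ed U c a]edC ![ed U c b]edC.
have {}h1 : ed U a b := h1; have {}h2 : ed U b c := h2; have {}h3 : ed U a c := h3.
by rewrite h1 h2 h3 !andbT; case: ifP.
Qed.

Lemma max_indicator (b1 b2 b3 b4 : bool) : (b1 + b2 + b3 + b4 <= 1)%N ->
  (Num.max ((b1 || b3)%:Z - (b2 || b4)%:Z) 0 = b1%:Z + b3%:Z :> int) /\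
  (Num.max (- ((b1 || b3)%:Z - (b2 || b4)%:Z)) 0 = b2%:Z + b4%:Z :> int).
Proof. by case: b1 b2 b3 b4 => [] [] [] []. Qed.

Lemma quad_coef (U : {set {set V}}) (a b c d : V) (e : {set V}) :
  triangulation U -> quad U a b c d ->
  (Num.max (tri_matrix U e [set a; c]) 0 = (e == [set a; b])%:Z + (e == [set c; d])%:Z) /\
  (Num.max (- tri_matrix U e [set a; c]) 0 = (e == [set b; c])%:Z + (e == [set d; a])%:Z).
Proof.
by move=> tU Q; rewrite (tri_matrix_col _ tU Q); apply: max_indicator; exact: (quad_excl _ Q).
Qed.

(** Two distinct adjacent edges have only one common vertex, and the triangle they
    bound has only one orientation. *)
Lemma tri_arrow_excl (U : {set {set V}}) e f : tri_arrow U e f -> tri_arrow U f e = false.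
Proof.
move=> /tri_arrowP[a [b [c [t eE fE]]]]; apply/tri_arrowP => [[x [y' [z [t' fE' eE']]]]].
have /and4P[abc _ _ _] := t; have /and4P[xyz _ _ _] := t'.
have [ab bc ac] := ccw_neq abc; have [xy yz xz] := ccw_neq xyz.
move/eqP: eE'; rewrite eE set2_eq => /orP[]/andP[/eqP ax /eqP bz];
  move/eqP: fE'; rewrite fE set2_eq => /orP[]/andP[/eqP ax' /eqP cy]; subst;
  rewrite ?eqxx // in ab bc ac xy yz xz *.
by move: abc xyz; rewrite /ccw; lia.
Qed.

Lemma initial_geometric : triangulation T -> initial_seed s0 ->
  (forall i : I, y (val i) = cluster s0 i) -> geometric_seed val s0.
Proof.
move=> tT [_ hcoef hexch hexch0] yI.
have coefP i : exists a b c d, [/\ quad T a b c d, val i = [set a; c],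
    coef_pos s0 i = q a b + q c d & coef_neg s0 i = q a d + q b c].
  have [a [c [ac _ iE]]] := diagonalP (triangulation_diag tT (valP i)).
  have acT : [set a; c] \in T by rewrite -iE; exact: (valP i).
  have [b [d Q]] := quad_exists tT acT; have [t1 t2] := quad_tri Q.
  have Q4 : ccw4 a b c d by case: Q.
  have [p m] := hcoef i a b c d Q4 (tri_triangle_of t1) (tri_triangle_of t2) iE.
  by exists a, b, c, d.
split; rewrite ?image_val //.
- move=> i e; have [a [b [c [d [Q -> -> _]]]]] := coefP i.
  by rewrite (quad_coef _ tT Q).1 ffunE !q_val.
- move=> i e; have [a [b [c [d [Q -> _ ->]]]]] := coefP i.
  by rewrite (quad_coef _ tT Q).2 ffunE !q_val addrC [[set d; a]]setUC.
- move=> i j; rewrite /tri_matrix.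
  have [/tri_arrowP[a [b [c [t iE jE]]]]|nij] := boolP (tri_arrow T (val i) (val j)).
    rewrite (hexch i j a b c) //; last exact: tri_triangle_of.
    have -> : tri_arrow T (val j) (val i) = false.
      by apply: tri_arrow_excl; apply/tri_arrowP; exists a, b, c.
    by case/and4P: t => ->.
  have [/tri_arrowP[a [c [b [t jE iE]]]]|nji] := boolP (tri_arrow T (val j) (val i)).
    have t' : triangle_of T a b c.
      case/and4P: (t) => /ccw_neq[ac cb ab] h1 h2 h3; rewrite /triangle_of /= !inE negb_or.
      by rewrite ab ac eq_sym cb /= -!/(edge _ _) edC h3 edC h2 h1.
    rewrite (hexch i j a b c) //; have acb : ccw a c b by case/and4P: t.
    by rewrite (negPf (ccw_asym acb)).
  apply: hexch0 => a b c /triangle_of_tri; case: ifP => _ t iE jE.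
    by case/negP: nij; apply/tri_arrowP; exists a, b, c.
  by case/negP: nji; apply/tri_arrowP; exists a, c, b.
Qed.


(** Sides are carried by the coefficients and diagonals by the cluster variables, so an
    edge appears in exactly one of the two products. *)
Lemma edge_monomial d s (x : {set V}) : geometric_seed d s -> edge (im d) x ->
  (\prod_(j : J) y (val j) ^+ (val j == x)) * (\prod_i y (d i) ^+ (d i == x)) = y x.
Proof.
move=> [tU dI _ _ _ _]; have [sx _|nsx /=] := boolP (is_side x).
  rewrite (bigD1 (Sub x sx : J)) //= eqxx big1 => [|j jx]; last first.
    suff /negPf -> : val j != x by rewrite expr0.
    by apply: contraNneq jx => jx; apply/eqP/val_inj.
  rewrite big1 ?mulr1 // => i _.
  suff /negPf -> : d i != x by rewrite expr0.
  apply: contraTneq sx => <-.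
  by have /andP[] : is_diagonal (d i) by apply: (triangulation_diag tU); apply: imset_f.
rewrite /edge (negPf nsx) /= => /imsetP[i _ xE].
rewrite big1 ?mul1r => [|j _]; last first.
  suff /negPf -> : val j != x by rewrite expr0.
  by apply: contraNneq nsx => <-; exact: (valP j).
rewrite (bigD1 i) //= -xE eqxx big1 ?mulr1 // => j ji.
by rewrite xE (inj_eq dI) (negPf ji) expr0.
Qed.

Lemma edge_monomial2 d s (p : trop J) (b : I -> int) (x x' : {set V}) :
  geometric_seed d s -> edge (im d) x -> edge (im d) x' ->
  (forall e, p e = (val e == x)%:Z + (val e == x')%:Z) ->
  (forall i, Num.max (b i) 0 = (d i == x)%:Z + (d i == x')%:Z) ->
  trop_inj n p * \prod_(i | 0 < b i) cluster s i ^ b i = y x * y x'.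
Proof.
move=> g ex ex' pE bE; rewrite trop_inj_prod.
rewrite -(edge_monomial g ex) -(edge_monomial g ex') mulrACA -!big_split /=.
congr (_ * _).
  by apply: eq_bigr => j _; rewrite pE -yJ -exprD -PoszD -exprnP.
rewrite big_mkcond; apply: eq_bigr => i _; rewrite -exprD -(geo_cluster g).
have := bE i; case: ltP => b0.
  by move=> ->; rewrite -PoszD -exprnP.
by move=> /esym/eqP; rewrite -PoszD => /eqP[->]; rewrite expr0.
Qed.

(** With the coefficients absorbed in the sides, the exchange relation is the Pluecker
    relation of the quadrilateral around the diagonal to be exchanged. *)
Lemma exchange_relation d s k (a b c e : V) : geometric_seed d s ->
  quad (im d) a b c e -> d k = [set a; c] ->
  trop_inj n (coef_pos s k) * \prod_(i | 0 < exch s i k) cluster s i ^ exch s i k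
  + trop_inj n (coef_neg s k) * \prod_(i | exch s i k < 0) cluster s i ^ (- exch s i k)
  = cluster s k * y [set b; e].
Proof.
move=> g Q dk; have tU := geo_triangulation g.
have [_ _ [ab bc] [ce ea]] := Q.
rewrite (edge_monomial2 g ab ce); first last.
- by move=> i; rewrite (geo_exch g) dk (quad_coef _ tU Q).1.
- by move=> j; rewrite (geo_pos g) dk (quad_coef _ tU Q).1.
have -> : \prod_(i | exch s i k < 0) cluster s i ^ (- exch s i k) =
    \prod_(i | 0 < - exch s i k) cluster s i ^ (- exch s i k).
  by apply: eq_bigl => i; rewrite oppr_gt0.
rewrite (edge_monomial2 g bc ea); first last.
- by move=> i; rewrite (geo_exch g) dk (quad_coef _ tU Q).2.
- by move=> j; rewrite (geo_neg g) dk (quad_coef _ tU Q).2.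
have Q4 : ccw4 a b c e by case: Q.
rewrite (geo_cluster g) dk (plk Q4).
by rewrite [[set a; e]]setUC [y [set b; c] * _]mulrC.
Qed.

Lemma flip_of_quad d s k (a b c e : V) : geometric_seed d s ->
  quad (im d) a b c e -> d k = [set a; c] ->
  let d' i := if i == k then [set b; e] else d i in
  im d' = flipset (im d) a b c e.
Proof.
move=> g Q dk d'; have [tU dI _ _ _ _] := g; apply/setP => x; rewrite !inE.
apply/imsetP/orP => [[i _ ->]|[/eqP->|/andP[nx /imsetP[i _ xE]]]].
- rewrite /d'; have [_|ik] := eqVneq i k; [by left | right].
  by rewrite -dk (inj_eq dI) ik imset_f.
- by exists k; rewrite // /d' eqxx.
- exists i => //; rewrite /d'; case: eqP => // ik.
  by move: nx; rewrite xE ik dk eqxx.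
Qed.

(** By [flip_unique] the new label is the other diagonal of the quadrilateral around
    the old one. *)
Lemma flip_quad d s k d' : geometric_seed d s -> flip d k d' ->
  exists a b c e, [/\ quad (im d) a b c e, d k = [set a; c], d' k = [set b; e] &
    im d' = flipset (im d) a b c e].
Proof.
move=> g [dE dk tU']; have [tU dI _ _ _ _] := g.
have kU : d k \in im d by apply: imset_f.
have [a [c [ac _ kE]]] := diagonalP (triangulation_diag tU kU).
rewrite kE in kU; have [b [e Q]] := quad_exists tU kU.
have d'E : im d' = d' k |: (im d :\ [set a; c]).
  apply/setP => x; rewrite !inE; apply/imsetP/orP => [[i _ ->]|[/eqP->|/andP[nx /imsetP[i _ xE]]]].
  - have [->|ik] := eqVneq i k; [by left|right].
    by rewrite dE // -kE (inj_eq dI) ik imset_f.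
  - by exists k.
  - exists i => //; rewrite dE //; apply: contraNneq nx => ik; by rewrite xE ik kE.
have d'k : d' k = [set b; e].
  by apply: (flip_unique tU Q); rewrite -?d'E // -kE.
by exists a, b, c, e; rewrite d'E d'k.
Qed.

Lemma tri_matrix_range (U : {set {set V}}) e f :
  [\/ tri_matrix U e f = 0, tri_matrix U e f = 1 | tri_matrix U e f = -1].
Proof.
rewrite /tri_matrix; case: tri_arrow; case: tri_arrow;
  by [constructor 1 | constructor 2 | constructor 3].
Qed.

(** One entry of a normalized pair is 0 and the other one is positive or 0, so the pair
    is the positive and negative part of its quotient. *)
Lemma trop_normal (p m : trop J) (r : J -> int) :
  trop_oplus p m = 0 -> (forall e, p e - m e = r e) ->
  forall e, p e = Num.max (r e) 0 /\ m e = Num.max (- r e) 0.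
Proof.
by move=> /ffunP pm rE e; have := pm e; rewrite !ffunE -rE; split; lia.
Qed.

Lemma trop_subE (p m : trop J) e : (p - m) e = p e - m e.
Proof. by rewrite !ffunE. Qed.

Lemma trop_addE (p m : trop J) e : (p + m) e = p e + m e.
Proof. by rewrite !ffunE. Qed.

Lemma trop_mulzE (p : trop J) z e : (p *~ z) e = p e * z.
Proof.
case: z => k; last rewrite NegzE mulrNz mulrN; rewrite -pmulrn; last rewrite ffunE.
all: by rewrite ffunMnE -mulr_natr natz.
Qed.

(** The coefficients follow the same rule as the exchange matrix because the quotient
    of the two coefficients is the corresponding column of the rows indexed by sides. *)
Lemma mutation_geometric d s k d' s' : geometric_seed d s -> mutation s k s' ->
  flip d k d' -> geometric_seed d' s'.
Proof.
move=> g [mC mk mN mR mE] fl; have [a [b [c [e [Q dk d'k imE]]]]] := flip_quad g fl.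
have [dE _ tU'] := fl; have [tU dI gC gP gM gE] := g.
have Q4 : ccw4 a b c e by case: Q.
have acU : [set a; c] \in im d by case: Q.
have beU : [set b; e] \notin im d.
  by have /norP[] := negbT (quad_notin tU Q).
have dne i : i != k -> [/\ d i != [set a; c], d i != [set b; e] & d' i = d i].
  move=> ik; split; last exact: dE.
    by rewrite -dk (inj_eq dI).
  by apply: contraNneq beU => <-; apply: imset_f.
have dI' : injective d'.
  move=> i j; have [->|ik] := eqVneq i k; have [->|jk] := eqVneq j k => //.
  - by have [_ h ->] := dne j jk; rewrite d'k => E; rewrite E eqxx in h.
  - by have [_ h ->] := dne i ik; rewrite d'k => E; rewrite E eqxx in h.
  - by have [_ _ ->] := dne i ik; have [_ _ ->] := dne j jk; apply: dI.
have sne (j : J) : val j != [set a; c] /\ val j != [set b; e].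
  have sj : is_side (val j) := valP j.
  have bd : is_diagonal [set b; e] by apply: (@flip_diag _ b c e a); rewrite ccw4_rot.
  split; apply: contraTneq sj => ->; first by have /andP[] := triangulation_diag tU acU.
  by case/andP: bd.
have ratio i (j : J) : coef_pos s' i j - coef_neg s' i j = tri_matrix (im d') (val j) (d' i).
  have [sac sbe] := sne j.
  have := congr1 (fun p : trop J => p j) (mR i); rewrite trop_subE => ->.
  rewrite imE; have [->|ik] := eqVneq i k.
    rewrite trop_subE d'k (tri_matrix_flip_col _ tU Q) gP gM dk.
    by case: (tri_matrix_range (im d) (val j) [set a; c]) => ->.
  have [h1 h2 ->] := dne i ik.
  rewrite (tri_matrix_flip tU Q) // trop_addE trop_subE gP gM gE dk.
  rewrite [X in X + _](_ : _ = (`|tri_matrix (im d) (val j) [set a; c]| * tri_matrix (im d) [set a; c] (d i)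
       + tri_matrix (im d) (val j) [set a; c] * `|tri_matrix (im d) [set a; c] (d i)|) %/ 2)%Z; last first.
    have EP := gP k j; have EM := gM k j; rewrite dk in EP EM.
    case: ifP; rewrite trop_mulzE ?EP ?EM;
    case: (tri_matrix_range (im d) (val j) [set a; c]) => ->;
    by case: (tri_matrix_range (im d) [set a; c] (d i)) => ->.
  rewrite addrC; congr (_ + _).
  by case: (tri_matrix_range (im d) (val j) (d i)) => ->.
have coef i (j : J) := trop_normal (mN i) (ratio i) j.
split; [exact: tU' | exact: dI' | | | |].
- move=> i; have [->|ik] := eqVneq i k; last by have [_ _ ->] := dne i ik; rewrite mC // gC.
  have := mk; rewrite (exchange_relation g Q dk) d'k => /mulfI; apply.
  by rewrite gC dk; apply: nz; case/andP: Q4 => /ccw_neq[].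
- by move=> i j; rewrite (coef i j).1.
- by move=> i j; rewrite (coef i j).2.
- move=> i j; rewrite mE imE.
  have [->|ik] := eqVneq i k; have [->|jk] := eqVneq j k; rewrite /= ?d'k ?gE.
  + by rewrite dk /tri_matrix !subrr oppr0.
  + have [_ _ ->] := dne j jk; rewrite dk.
    by rewrite -tri_matrix_anti [RHS]tri_matrix_anti (tri_matrix_flip_col _ tU Q) opprK.
  + by have [_ _ ->] := dne i ik; rewrite dk (tri_matrix_flip_col _ tU Q).
  + have [h1 h2 ->] := dne i ik; have [h3 h4 ->] := dne j jk.
    by rewrite (tri_matrix_flip tU Q h1 h3 h2 h4) dk.
Qed.

End Seeds.

(** * Cluster variables and coefficients that can be reached *)

Section Reach.
Variable n : nat.
Notation V := 'I_n.+3.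
Notation ed T a b := (edge T [set a; b]).
Notation K := (ambient (side n) n).
Variables (T : {set {set V}}) (s0 : tri_seed T).
Notation I := (diag_of T).
Notation J := (side n).
Variable y : {set V} -> K.
Hypothesis yJ : forall j : J, y (val j) = trop_inj n (trop_var j).
Hypothesis yI : forall i : I, y (val i) = cluster s0 i.
Hypothesis plk : plucker_rel y.
Hypothesis nz : forall a b : V, a != b -> y [set a; b] != 0.
Hypothesis tT : triangulation T.
Hypothesis hs0 : initial_seed s0.

Notation im d := [set d i | i : I].
Notation geo := (geometric_seed y).

Lemma labelled_geometric (d : I -> {set V}) (s : tri_seed T) : labelled_seed s0 d s -> geo d s.
Proof.
elim=> [|d1 s1 k d' s' _ g m f]; first exact: initial_geometric.
exact: mutation_geometric g m f.
Qed.

Lemma labelled_mutation_equiv d s : labelled_seed s0 d s -> mutation_equiv s0 s.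
Proof.
elim=> [|d1 s1 k d' s' _ IH m _]; first exact: mutation_equiv_refl.
exact: mutation_equiv_step IH m.
Qed.

(** Dividing the exchange relation by the old variable gives the new one, and the
    coefficients are the positive and negative parts of their prescribed quotient. *)
Lemma mutation_exists (s : tri_seed T) k : cluster s k != 0 -> exists s', mutation s k s'.
Proof.
move=> nk; pose b := exch s.
pose x' := (trop_inj n (coef_pos s k) * \prod_(i | 0 < b i k) cluster s i ^ b i k
        + trop_inj n (coef_neg s k) * \prod_(i | b i k < 0) cluster s i ^ - b i k) / cluster s k.
pose r i : trop J := if i == k then coef_neg s k - coef_pos s k
         else (if 0 <= b k i then coef_pos s k *~ b k i
               else coef_neg s k *~ b k i)
              + (coef_pos s i - coef_neg s i).
exists (@Seed _ _ _ (fun i => if i == k then x' else cluster s i)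
  (fun i => [ffun e => Num.max (r i e) 0]) (fun i => [ffun e => Num.max (- r i e) 0])
  (fun i j => if (i == k) || (j == k) then - b i j
         else b i j + ((`|b i k| * b k j + b i k * `|b k j|)%R %/ 2)%Z)).
split=> //=.
- by move=> i /negPf->.
- by rewrite eqxx mulrC divfK.
- move=> i; apply/ffunP => e; rewrite !ffunE; move: (r i e) => z. lia.
- move=> i; rewrite -/(r i); apply/ffunP => e; rewrite trop_subE [X in X - _]ffunE [X in _ - X]ffunE.
  by move: (r i e) => z; lia.
Qed.

Lemma geometric_flip (d : I -> {set V}) (s : tri_seed T) k :
  geo d s -> exists d' s', mutation s k s' /\ flip d k d'.
Proof.
move=> g; have [tU dI gC _ _ _] := g.
have kU : d k \in im d by apply: imset_f.
have [a [c [ac _ kE]]] := diagonalP (triangulation_diag tU kU).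
have kU' := kU; rewrite kE in kU'; have [b [e Q]] := quad_exists tU kU'.
have [s' m] : exists s', mutation s k s'.
  by apply: mutation_exists; rewrite gC kE nz.
exists (fun i => if i == k then [set b; e] else d i), s'; split=> //; split.
- by move=> i /negPf->.
- rewrite eqxx kE; apply/eqP => E.
  by have /norP[_ /negP] := negbT (quad_notin tU Q); rewrite E.
- by rewrite (flip_of_quad g Q kE); apply: triangulation_flip.
Qed.

Lemma mutation_equiv_labelled s : mutation_equiv s0 s -> exists d, labelled_seed s0 d s.
Proof.
elim=> [|s1 k s' _ [d l] m]; first by exists val; exact: labelled_seed_init.
have [d' [s2 [_ f]]] := geometric_flip k (labelled_geometric l).
by exists d'; apply: labelled_seed_step l m f.
Qed.

(** Stars of vertices contain all diagonals, so reaching them is enough to reach all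
    cluster variables and, by [side_in_algebra], all coefficients. *)
Lemma reach_star (v : V) : exists d s, labelled_seed s0 d s /\
  forall w, w != v -> ed (im d) v w.
Proof.
suff : forall U, triangulation U -> forall d s, labelled_seed s0 d s -> im d = U ->
    exists d s, labelled_seed s0 d s /\ forall w, w != v -> ed (im d) v w.
  by move=> /(_ _ tT _ _ (labelled_seed_init s0)); apply; exact: image_val.
apply: (flip_induction (v := v)) => [U tU star d s l dU|U a b c e tU Q IH d s l dU].
  by exists d, s; split=> // w; rewrite dU; exact: star.
have /imsetP[k _ dk] : [set a; c] \in im d by rewrite dU; case: Q.
have g := labelled_geometric l.
have [s' m] : exists s', mutation s k s'.
  apply: mutation_exists; rewrite (geo_cluster g) -dk nz //.
  by case: Q => /andP[/ccw_neq[]].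
pose d' i := if i == k then [set b; e] else d i.
have d'E : im d' = flipset U a b c e.
  by rewrite -dU; apply: (flip_of_quad g); rewrite ?dU.
apply: (IH d' s' _ d'E); apply: labelled_seed_step l m _; split.
- by move=> i /negPf ik; rewrite /d' ik.
- rewrite /d' eqxx -dk; apply/eqP => E.
  by have /norP[_ /negP] := negbT (quad_notin tU Q); rewrite E; case: Q.
- by rewrite d'E; apply: triangulation_flip.
Qed.

Lemma is_xE (a b : V) z : is_x s0 a b z -> z = y [set a; b].
Proof. by move=> [d [s [i [l <- ->]]]]; rewrite (geo_cluster (labelled_geometric l)). Qed.

Lemma is_x_exists (a b : V) : a != b -> ~~ is_side [set a; b] -> is_x s0 a b (y [set a; b]).
Proof.
move=> ab ns; have [d [s [l star]]] := reach_star a.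
have : ed (im d) a b by apply: star; rewrite eq_sym.
rewrite /edge (negPf ns) /= => /imsetP[i _ iE].
by exists d, s, i; split=> //; rewrite (geo_cluster (labelled_geometric l)) -iE.
Qed.

Lemma is_pE (a b : V) : is_side [set a; b] -> trop_inj n (q a b) = y [set a; b].
Proof. by move=> sab; rewrite /q insubT -yJ. Qed.

Lemma is_generatorE (a b : V) z : a != b -> is_generator s0 a b z <-> z = y [set a; b].
Proof.
move=> ab; rewrite /is_generator; case: ifP => [sab|/negbT ns].
  by rewrite /is_p is_pE.
by split=> [/is_xE//|->]; apply: is_x_exists.
Qed.

(** In the star of v, the first coefficient of the diagonal [v, a] with a = v + 3 comes
    from [a, a + 1] and [v, v + 2].  As the polygon has at least five vertices, [v, a] and
    [v, v + 2] are diagonals, and the coefficient is the side [a, a + 1] alone. *)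
Lemma side_in_algebra (a : V) : (2 <= n)%N -> y [set a; ordS a] \in in_subring_gen (cluster_generator s0).
Proof.
move=> hn; pose b := ord_pred a; pose b' := ord_pred b; pose v := ord_pred b'.
(* The consecutive vertices are v, b', b, a, ordS a. *)
have hb : ordS b = a := ord_predK a; have hb' : ordS b' = b := ord_predK b.
have hv : ordS v = b' := ord_predK b'.
have [d [s [l star]]] := reach_star v; have g := labelled_geometric l.
have tU := geo_triangulation g.
have [P1 P2 P3 P4] := And4 (ordSP a) (ordSP b) (ordSP b') (ordSP v).
rewrite hb in P2; rewrite hb' in P3; rewrite hv in P4.
have Q4 : ccw4 v b a (ordS a).
  rewrite /ccw4 /ccw; clear -P1 P2 P3 P4 hn.
  move: (nat_of_ord (ordS a)) (nat_of_ord a) (nat_of_ord b) (nat_of_ord b') (nat_of_ord v) P1 P2 P3 P4.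
  by move=> *; lia.
have nsa : ~~ is_side [set v; a].
  rewrite is_side2 hv !eq_ord; clear -P1 P2 P3 P4 hn.
  move: (nat_of_ord (ordS a)) (nat_of_ord a) (nat_of_ord b) (nat_of_ord b') (nat_of_ord v) P1 P2 P3 P4.
  by move=> *; lia.
have nsb : ~~ is_side [set v; b].
  rewrite is_side2 hv hb !eq_ord; clear -P1 P2 P3 P4 hn.
  move: (nat_of_ord (ordS a)) (nat_of_ord a) (nat_of_ord b) (nat_of_ord b') (nat_of_ord v) P1 P2 P3 P4.
  by move=> *; lia.
have [vb ba aS vS] : [/\ v != b, b != a, a != ordS a & v != ordS a].
  by have := ccw4_uniq Q4; rewrite /= !inE !negb_or => /and4P[/and3P[-> _ ->] /andP[-> _] ->].
have va : v != a by case/andP: Q4 => /ccw_neq[].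
have vaU : [set v; a] \in im d.
  by have := star a; rewrite eq_sym va /edge (negPf nsa) => /(_ isT).
have Q : quad (im d) v b a (ordS a).
  split=> //; split.
  - by apply: star; rewrite eq_sym.
  - by rewrite /edge is_side2 hb eqxx.
  - by rewrite /edge is_side2 eqxx.
  - by rewrite edC; apply: star; rewrite eq_sym.
have /imsetP[k _ kE] := vaU.
apply: mem_subring_gen; exists s; first exact: labelled_mutation_equiv l.
exists k; constructor 2; rewrite -is_pE ?is_side2 ?eqxx //; congr (trop_inj n _).
apply/ffunP => e; rewrite q_val (geo_pos g) -kE (quad_coef _ tU Q).1.
suff /negPf -> : val e != [set v; b] by rewrite add0r.
by apply: contraNneq nsb => <-; exact: (valP e).
Qed.

Hypothesis y0 : forall e, (forall a b : V, a != b -> e != [set a; b]) -> y e = 0.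

Lemma y_in_algebra (e : {set V}) : (2 <= n)%N -> y e \in in_subring_gen (cluster_generator s0).
Proof.
move=> hn; have [/existsP[a /existsP[b /andP[ab /eqP->]]]|H] :=
      boolP [exists a : V, exists b : V, (a != b) && (e == [set a; b])]; last first.
  rewrite y0 ?rpred0 // => a b ab; apply: contra H => eab.
  by apply/existsP; exists a; apply/existsP; exists b; rewrite ab.
have [|ns] := boolP (is_side [set a; b]).
  by rewrite is_side2 => /orP[]/eqP->; [|rewrite setUC]; apply: side_in_algebra.
have [d [s [i [l _ ->]]]] := is_x_exists ab ns.
apply: mem_subring_gen; exists s; first exact: labelled_mutation_equiv l.
by exists i; constructor 1.
Qed.

(** The coefficients of a geometric seed are monomials with nonnegative exponents in
    the sides, so coefficients and cluster variables are all expressions in y. *)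
Lemma algebra_terms z : (2 <= n)%N ->
  z \in in_subring_gen (cluster_generator s0) <-> exists t, z = evalT y t.
Proof.
move=> hn; apply: in_subring_genP => [{}z [s me [i H]]|e]; last exact: y_in_algebra.
have [d l] := mutation_equiv_labelled me; have g := labelled_geometric l.
pose Sy z := exists e, z = y e.
apply/(@in_subring_genP _ _ Sy); first by move=> _ [e ->]; exists (RVar e).
  by move=> e; apply: mem_subring_gen; exists e.
have trop_mem (p : trop J) : (forall e, 0 <= p e) -> trop_inj n p \in in_subring_gen Sy.
  move=> p0; rewrite trop_inj_prod; apply: rpred_prod => j _.
  have := p0 j; case: (p j) => // k _; rewrite -exprnP; apply: rpredX.
  by rewrite -yJ; apply: mem_subring_gen; exists (val j).
case: H => ->.
- by rewrite (geo_cluster g); apply: mem_subring_gen; exists (d i).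
- by apply: trop_mem => e; rewrite (geo_pos g); lia.
- by apply: trop_mem => e; rewrite (geo_neg g); lia.
Qed.

End Reach.

(** * The isomorphism *)

Theorem proposition12p7 (R : realType) (n : nat) (hn : (2 <= n)%N)
    (T : {set {set 'I_n.+3}}) (hT : triangulation T)
    (s0 : tri_seed T) (hs0 : initial_seed s0) :
  [/\ Z_form (@coord_const R[i] n) (Z_coord_ring R[i] n),
      (forall a b : 'I_n.+3, (a < b)%N ->
         exists z : cluster_algebra s0, is_generator s0 a b (val z)) &
      exists! phi : cluster_algebra s0 -> Z_coord_ring R[i] n,
        ring_isomorphism phi /\
        (forall (a b : 'I_n.+3) (z : cluster_algebra s0),
           (a < b)%N -> is_generator s0 a b (val z) ->
           val (phi z) = plucker R[i] a b)].
Proof.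
have [y [yJ yI yrel]] := cluster_coordinates hT hs0.
have plk : plucker_rel y.
  (* Terms have no sum: x + y is written x - ((1 - 1) - y). *)
  move=> a b c d Q; pose prod (e f : {set 'I_n.+3}) := RMul (RVar e) (RVar f).
  have /= := (yrel (RSub (prod [set a; c] [set b; d])
    (RSub (prod [set a; b] [set c; d])
      (RSub (RSub ROne ROne) (prod [set a; d] [set b; c]))))).2.
  rewrite !subrr !sub0r !opprK => H; apply/eqP; rewrite -subr_eq0; apply/eqP/H.
  by rewrite (minor_plucker _ _ Q) subrr.
have nz (a b : 'I_n.+3) : a != b -> y [set a; b] != 0.
  move=> ab; apply/eqP => /(yrel (RVar _))/eqP; apply/negP.
  exact: gminor_neq0.
have y0 e : (forall a b : 'I_n.+3, a != b -> e != [set a; b]) -> y e = 0.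
  by move=> H; apply/(yrel (RVar _)); exact: minor_nonedge.
have lt_neq (a b : 'I_n.+3) : (a < b)%N -> a != b by rewrite eq_ord neq_ltn => ->.
have genE (a b : 'I_n.+3) z : (a < b)%N -> is_generator s0 a b z <-> z = y [set a; b].
  by move=> /lt_neq; apply: is_generatorE.
have memE z := algebra_terms yJ yI plk nz hT hs0 y0 z hn.
have memy e : y e \in in_subring_gen (cluster_generator s0) by apply/memE; exists (RVar e).
split; first exact: coord_Z_form.
- by move=> a b ab; exists (SubringGen (memy [set a; b])); apply/genE.
have rel t : evalT y t = 0 <-> evalT (@plucker_edge R[i] n) t = 0.
  by rewrite yrel coord_relations.
have [phi [[iso phiE] uniq]] := generated_iso memE (@Z_coord_ringP R[i] n) rel.
have pairP e : (exists a b : 'I_n.+3, (a < b)%N /\ e = [set a; b]) \/ y e = 0.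
  have [/existsP[a /existsP[b /andP[ab /eqP->]]]|H] :=
      boolP [exists a : 'I_n.+3, exists b : 'I_n.+3, (a < b)%N && (e == [set a; b])].
    by left; exists a, b.
  right; apply: y0; apply: (@set2_wlog n (fun f => e != f)) => a b ab; apply: contra H => eab.
  by apply/existsP; exists a; apply/existsP; exists b; rewrite ab.
exists phi; split.
  by split=> // a b z ab /(genE _ _ _ ab)/phiE ->; exact: plucker_edgeE.
move=> psi [psi_iso psiE]; apply: uniq; split=> // e z zE.
have [[a [b [ab eE]]]|ye] := pairP e.
  by rewrite eE plucker_edgeE //; apply: psiE => //; apply/genE; rewrite // zE eE.
have z0 : z = 0 by apply/val_inj; rewrite zE ye.
have [psiB _ _] := psi_iso.
have -> : psi z = 0 by rewrite z0 -(subrr 0) psiB subrr.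
by apply/esym/(rel (RVar e)).
Qed.
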